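(* Let $\rho\in\mathbb{R}^n_{>0}$ and let $P$ be an object in $\mathscr{C}_\rho$. Then there exists an exponent $A$ for $P$.
   Context: Fix a prime $p$, a complete nonarchimedean field $K$ of mixed characteristic $(0,p)$ with $|p|=p^{-1}$, and an integer $n\ge1$. For $\alpha,\beta\in\mathbb{R}^n$, $\alpha<\beta$ means $\alpha_i<\beta_i$ for all $i$. A closed polysegment is $J=[\alpha,\beta]=\prod_{i=1}^n[\alpha_i,\beta_i]\subset\mathbb{R}_{>0}^n$. $K_{J,n}$ is the ring of Laurent series $f=\sum_{i\in\mathbb{Z}^n}f_it^i$, $f_i\in K$, with $\lim_{|i|\to\infty}|f_i|\rho^i=0$ for all $\rho\in J$ (where $|i|=\sum_j|i_j|$, $\rho^i=\prod_j\rho_j^{i_j}$); $|f|_\rho=\max_i|f_i|\rho^i$ and $|f|_J=\max_{\rho\in J}|f|_\rho$ (the supremum norm); these norms extend to series with coefficients in $K(\Gamma)$, and norms of matrices are maxima over entries. $R_\rho=\varinjlim_JK_{J,n}$ over closed polysegments $J$ containing $\rho$ in their interior. $\Gamma_s$ is the group of $p^s$-th roots of unity in a fixed algebraic closure of $K$ and $\Gamma=\bigcup_{s>0}\Gamma_s$; $\Gamma_s^n$ and $\Gamma^n$ are the products of $n$ copies. $\zeta\in\Gamma^n$ acts on $K_{J,n}\otimes_KK(\Gamma)$ and on $R_\rho\otimes_KK(\Gamma)$ by $\zeta^*(f(t))=f(\zeta t)$, $\zeta t=(\zeta_1t_1,\dots,\zeta_nt_n)$. The category $\mathscr{C}_\rho$: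 objects are finite free $R_\rho$-modules $P$ endowed with a semilinear group action of $\Gamma^n$ on $P\otimes_KK(\Gamma)$ (so $\zeta^*(fx)=\zeta^*(f)\zeta^*(x)$) such that: (1) $P$ is extended from a finite free $K_{J,n}$-module $P'$ for some closed polysegment $J$ containing $\rho$ in its interior, and the action is induced from a semilinear group action of $\Gamma^n$ on $P'\otimes_KK(\Gamma)$; (2) $\sigma(\zeta^*(x))=\sigma(\zeta)^*(\sigma(x))$ for all $\sigma\in\mathrm{Gal}(K(\Gamma)/K)$, $\zeta\in\Gamma^n$, $x\in P\otimes_KK(\Gamma)$; (3) for some basis $e_1,\dots,e_m$ of $P'$ there is $l>0$ such that for each positive integer $k$ and each $\zeta\in\Gamma^n_k$ the matrix $E(\zeta)$ of $\zeta^*$ in this basis ($\zeta^*(e_1,\dots,e_m)=(e_1,\dots,e_m)E(\zeta)$) satisfies $|E(\zeta)|_J\le p^{lk}$. For $P'$ as in (1)–(3) one says $P$ is defined by $P'$ over $J$. Morphisms are $R_\rho$-linear maps compatible with the $\Gamma^n$-actions. Exponents: let $P\in\mathscr{C}_\rho$ be free of rank $m$. Take $\alpha<\rho<\beta$ such that $P$ is defined by $P'$ over $[\alpha,\beta]$ and a basis $e_1,\dots,e_m$ of $P'$. An exponent of $P$ (admitted by $P'$) is an $n$-tuple $A=(A^1,\dots,A^n)$ of diagonal $m\times m$ matrices with entries in $\mathbb{Z}_p$ for which there is a sequence $S_{k,A}\in\mathrm{M}_m(K_{[\alpha,\beta],n})$, $k\ge1$, such that: (1) with $(v_{k,A,1},\dots,v_{k,A,m})=(e_1,\dots,e_m)S_{k,A}$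 one has $\zeta^*(v_{k,A,1},\dots,v_{k,A,m})=(v_{k,A,1},\dots,v_{k,A,m})\zeta^A$ for all $\zeta\in\Gamma_k^n$, where $\zeta^A=\zeta_1^{A^1}\cdots\zeta_n^{A^n}$ with $\zeta_i^{A^i}$ the diagonal matrix whose entries are the powers of $\zeta_i$ by the diagonal entries of $A^i$; (2) there is $l>0$ with $|S_{k,A}|_{[\alpha,\beta]}\le p^{lk}$ for all $k$; (3) $|\det S_{k,A}|_{[\alpha,\beta]}\ge1$ for all $k$. *)

(* Defs.v *)
From HB Require Import structures.
From mathcomp Require Import all_boot all_order all_algebra finmap.
From mathcomp Require Import zify.
From mathcomp Require Import boolp classical_sets functions reals constructive_ereal ereal.

Set Implicit Arguments.
Unset Strict Implicit.
Unset Printing Implicit Defensive.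
Import Order.TTheory GRing.Theory Num.Theory.
Local Open Scope ring_scope.

Record nonarch_abs (R : realType) (F : fieldType) (v : F -> R) : Prop :=
  NonarchAbs {
    nabs_ge0 : forall x, 0 <= v x;
    nabs_eq0 : forall x, v x = 0 <-> x = 0;
    nabsM : forall x y, v (x * y) = v x * v y;
    nabsD : forall x y, v (x + y) <= Num.max (v x) (v y) }.

Definition abs_complete (R : realType) (F : fieldType) (v : F -> R) : Prop :=
  forall u : nat -> F,
    (forall e : R, 0 < e -> exists N : nat, forall i j : nat,
        (N <= i)%N -> (N <= j)%N -> v (u i - u j) < e) ->
    exists x : F, forall e : R, 0 < e -> exists N : nat, forall i : nat,
        (N <= i)%N -> v (u i - x) < e.

(* Unordered sums: convergence along the directed set of finite subsets. *)
Definition has_sum (R : realType) (F : fieldType) (v : F -> R)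
    (T : choiceType) (u : T -> F) (x : F) : Prop :=
  forall e : R, 0 < e -> exists A : {fset T}, forall B : {fset T},
    (A `<=` B)%fset -> v (\sum_(t <- B) u t - x) < e.

(* The value is 0 when the family is not summable. *)
Definition tsum (R : realType) (F : fieldType) (v : F -> R)
    (T : choiceType) (u : T -> F) : F :=
  xget 0 [set x | has_sum v u x].

(* Coefficients of the product of two Laurent series. *)
Definition conv (R : realType) (F : fieldType) (v : F -> R) (n : nat)
    (f g : 'rV[int]_n -> F) : 'rV[int]_n -> F :=
  fun i => tsum v (fun j => f j * g (i - j)).

Definition lmonom (F : fieldType) (n : nat) (z : 'I_n -> F) (i : 'rV[int]_n)
  : F := \prod_(j < n) z j ^ i 0 j.

Definition unit_series (F : fieldType) (n : nat) (c : F) : 'rV[int]_n -> F :=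
  fun i => if i == 0 then c else 0.

Definition l1norm (n : nat) (i : 'rV[int]_n) : nat := (\sum_(j < n) `|i ord0 j|)%N.

Definition rnum (R : realType) (n : nat) (r : 'I_n -> {posnum R}) : 'I_n -> R :=
  fun j => (r j)%:num.

Definition decays (R : realType) (F : fieldType) (v : F -> R) (n : nat)
    (r : 'I_n -> {posnum R}) (f : 'rV[int]_n -> F) : Prop :=
  forall e : R, 0 < e -> exists N : nat, forall i : 'rV[int]_n,
    (N <= l1norm i)%N -> v (f i) * lmonom (rnum r) i < e.

Section Summation.
Variables (R : realType) (F : fieldType) (v : F -> R).
Hypothesis hv : nonarch_abs v.

Lemma nabs0 : v 0 = 0. Proof. by apply/(nabs_eq0 hv). Qed.

Lemma nabs1 : v 1 = 1.
Proof.
have n0 : v 1 != 0.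
  by apply/eqP => /(nabs_eq0 hv)/eqP; rewrite oner_eq0.
by apply: (mulfI n0); rewrite -(nabsM hv) !mulr1.
Qed.

Lemma nabsN x : v (- x) = v x.
Proof.
have h : v (-1) = 1.
  have /eqP : v (-1) ^+ 2 = 1 by rewrite expr2 -(nabsM hv) mulrNN mulr1 nabs1.
  rewrite sqrf_eq1 => /orP[/eqP //|/eqP h].
  by have := nabs_ge0 hv (-1); rewrite h ler0N1.
by rewrite -mulN1r (nabsM hv) h mul1r.
Qed.

Lemma nabsB x y : v (x - y) = v (y - x).
Proof. by rewrite -nabsN opprB. Qed.

Lemma nabsD_lt e x y : v x < e -> v y < e -> v (x + y) < e.
Proof. by move=> h1 h2; apply: le_lt_trans (nabsD hv _ _) _; rewrite gt_max h1. Qed.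

Lemma nabsD_le e x y : v x <= e -> v y <= e -> v (x + y) <= e.
Proof. by move=> h1 h2; apply: le_trans (nabsD hv _ _) _; rewrite ge_max h1. Qed.

Lemma nabs_sum_lt e (T : eqType) (s : seq T) (u : T -> F) :
  0 < e -> (forall t, t \in s -> v (u t) < e) -> v (\sum_(t <- s) u t) < e.
Proof.
move=> e0 h; rewrite big_seq; elim/big_ind: _ => //; first by rewrite nabs0.
by move=> x y; apply: nabsD_lt.
Qed.

Lemma nabs_sum_le e (T : eqType) (s : seq T) (u : T -> F) :
  0 <= e -> (forall t, t \in s -> v (u t) <= e) -> v (\sum_(t <- s) u t) <= e.
Proof.
move=> e0 h; rewrite big_seq; elim/big_ind: _ => //; first by rewrite nabs0.
by move=> x y; apply: nabsD_le.
Qed.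

Lemma nabs_small x : (forall e, 0 < e -> v x < e) -> x = 0.
Proof.
move=> h; apply/(nabs_eq0 hv); apply/eqP; rewrite eq_le (nabs_ge0 hv) andbT.
by rewrite leNgt; apply/negP => /h; rewrite ltxx.
Qed.

Section OneFamily.
Variable T : choiceType.
Implicit Types (u : T -> F) (x y : F).

Lemma has_sum_unique u x y : has_sum v u x -> has_sum v u y -> x = y.
Proof.
move=> hx hy; apply/eqP; rewrite -subr_eq0; apply/eqP; apply: nabs_small => e e0.
have [A hA] := hx _ e0; have [B hB] := hy _ e0.
have -> : x - y = (x - \sum_(t <- (A `|` B)%fset) u t)
                  + (\sum_(t <- (A `|` B)%fset) u t - y) by rewrite addrA subrK.
apply: nabsD_lt; last by apply: hB; rewrite fsubsetUr.
by rewrite nabsB; apply: hA; rewrite fsubsetUl.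
Qed.

Lemma tsumE u x : has_sum v u x -> tsum v u = x.
Proof. by move=> h; apply: xget_unique => // y hy; exact: has_sum_unique hy h. Qed.

Lemma eq_has_sum u u' x : u =1 u' -> has_sum v u x -> has_sum v u' x.
Proof. by move=> /funext ->. Qed.

Lemma has_sumD u u' x x' : has_sum v u x -> has_sum v u' x' ->
  has_sum v (fun t => u t + u' t) (x + x').
Proof.
move=> h h' e e0; have [A hA] := h _ e0; have [A' hA'] := h' _ e0.
exists (A `|` A')%fset => B /fsubUsetP[AB A'B].
by rewrite big_split /= opprD addrACA; apply: nabsD_lt; [apply: hA|apply: hA'].
Qed.

Lemma has_sum0 : has_sum v (fun _ : T => 0) 0.
Proof. by move=> e e0; exists fset0 => B _; rewrite big1 // subrr nabs0. Qed.

Lemma has_sumZ c u x : has_sum v u x -> has_sum v (fun t => c * u t) (c * x).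
Proof.
move=> h e e0; have [->|c0] := eqVneq c 0.
  by exists fset0 => B _; rewrite big1 => [|t _]; rewrite mul0r ?subrr ?nabs0.
have vc : 0 < v c.
  by rewrite lt_neqAle eq_sym (nabs_ge0 hv) andbT; apply/eqP => /(nabs_eq0 hv)/eqP; apply/negP.
have [A hA] := h _ (divr_gt0 e0 vc).
exists A => B AB; rewrite -mulr_sumr -mulrBr (nabsM hv) mulrC.
by rewrite -ltr_pdivlMr // hA.
Qed.

Lemma has_sumZr c u x : has_sum v u x -> has_sum v (fun t => u t * c) (x * c).
Proof.
by move=> /(has_sumZ c); rewrite mulrC; apply: eq_has_sum => t; rewrite mulrC.
Qed.

Lemma has_sum_big (S : Type) (s : seq S) (w : S -> T -> F) (x : S -> F) :
  (forall k, has_sum v (w k) (x k)) ->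
  has_sum v (fun t => \sum_(k <- s) w k t) (\sum_(k <- s) x k).
Proof.
move=> h; elim: s => [|k s IH].
  by rewrite big_nil; apply: eq_has_sum has_sum0 => t; rewrite big_nil.
by rewrite big_cons; apply: eq_has_sum (has_sumD (h k) IH) => t; rewrite big_cons.
Qed.

Lemma has_sum_le u x c : 0 <= c -> has_sum v u x -> (forall t, v (u t) <= c) ->
  v x <= c.
Proof.
move=> c0 h hu; rewrite leNgt; apply/negP => cx.
have [A hA] := h _ (le_lt_trans c0 cx).
have := hA A (fsubset_refl _); set s := \sum_(t <- A) u t => hs.
have : v (s - (s - x)) < v x.
  apply: nabsD_lt; last by rewrite nabsN.
  by apply: le_lt_trans cx; apply: nabs_sum_le.
by rewrite opprB addrCA subrr addr0 ltxx.
Qed.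

Definition null (w : T -> R) : Prop :=
  forall e : R, 0 < e -> exists A : {fset T}, forall t, t \notin A -> w t < e.

Lemma null_le (w w' : T -> R) C : 0 <= C -> (forall t, w' t <= C * w t) ->
  (forall t, 0 <= w t) -> null w -> null w'.
Proof.
move=> C0 h w0 hw e e0.
have C1 : 0 < C + 1 by rewrite ltr_wpDl.
have [A hA] := hw _ (divr_gt0 e0 C1).
exists A => t /hA; rewrite ltr_pdivlMr // mulrC; apply: le_lt_trans.
by apply: le_trans (h t) _; rewrite ler_wpM2r // lerDl.
Qed.

Lemma null_bound (w : T -> R) : (forall t, 0 <= w t) -> null w ->
  exists2 M, 0 < M & forall t, w t <= M.
Proof.
move=> w0 hw; have [A hA] := hw _ ltr01.
have s0 : 0 <= \sum_(t <- A) w t by apply: sumr_ge0.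
exists (1 + \sum_(t <- A) w t); first by rewrite ltr_pwDl.
move=> t; have [tA|/hA/ltW h] := boolP (t \in A).
  rewrite (big_fsetD1 t) //= addrCA lerDl addr_ge0 //.
  by apply: sumr_ge0.
by apply: le_trans h _; rewrite lerDl.
Qed.

Lemma null_summable u : abs_complete v -> null (v \o u) ->
  exists x, has_sum v u x.
Proof.
move=> hc hu.
have eps (k : nat) : 0 < (k.+1%:R)^-1 :> R by rewrite invr_gt0 ltr0Sn.
have [A hA] := choice (fun k => hu _ (eps k)).
pose B := fix B k := if k is k'.+1 then (A k `|` B k')%fset else A 0%N.
have BA k : (A k `<=` B k)%fset by case: k => [|k] //=; rewrite fsubsetUl.
have Bmono k l : (k <= l)%N -> (B k `<=` B l)%fset.
  elim: l => [|l IH]; first by rewrite leqn0 => /eqP ->.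
  rewrite leq_eqVlt => /predU1P[->//|]; rewrite ltnS => /IH h.
  by apply: fsubset_trans h _; rewrite /= fsubsetUr.
have hB k (C : {fset T}) : (B k `<=` C)%fset ->
    v (\sum_(t <- C) u t - \sum_(t <- B k) u t) < (k.+1%:R)^-1.
  move=> kC; rewrite (big_fsetID _ (mem (B k)) C) /=.
  have -> : [fset x in C | x \in B k]%fset = B k.
    apply/fsetP => t; rewrite !inE /= andbC.
    by case: (boolP (t \in B k)) => //= /(fsubsetP kC) ->.
  rewrite addrAC subrr add0r; apply: nabs_sum_lt => // t.
  rewrite !inE /= => /andP[_ tB]; apply: hA.
  by apply: contra tB; apply/fsubsetP.
have small (e : R) : 0 < e -> exists k : nat, (k.+1%:R)^-1 < e.
  move=> e0; exists (Num.truncn e^-1).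
  rewrite invf_plt ?posrE ?ltr0Sn //.
  by rewrite truncnS_gt // invr_ge0 ltW.
have [x hx] : exists x : F, forall e : R, 0 < e -> exists N : nat, forall i : nat,
        (N <= i)%N -> v (\sum_(t <- B i) u t - x) < e.
  apply: hc => e /small[k ke]; exists k => i j ki kj.
  apply: lt_trans ke.
  rewrite -(subrKA (\sum_(t <- B k) u t)); apply: nabsD_lt.
    exact/hB/Bmono.
  by rewrite nabsB; exact/hB/Bmono.
exists x => e e0; have [k ke] := small _ e0; have [N hN] := hx _ e0.
exists (B (maxn k N)) => C hC.
rewrite -(subrKA (\sum_(t <- B (maxn k N)) u t)); apply: nabsD_lt.
  apply: lt_trans (hB _ _ hC) _; apply: le_lt_trans ke.
  by rewrite lef_pV2 ?posrE ?ltr0Sn // ler_nat ltnS leq_maxl.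
by apply: hN; rewrite leq_maxr.
Qed.

End OneFamily.

Lemma null_reindex (T T' : choiceType) (h : T -> T') (g : T' -> T) (w : T' -> R) :
  cancel h g -> null w -> null (w \o h).
Proof.
move=> hg hw e /hw[A hA]; exists [fset g t | t in A]%fset => t tA /=.
apply: hA; apply: contra tA => htA; apply/imfsetP; exists (h t); rewrite ?hg //.
Qed.

Lemma has_sum_reindex (T T' : choiceType) (h : T -> T') (g : T' -> T)
    (u : T' -> F) x :
  cancel h g -> cancel g h -> has_sum v u x -> has_sum v (u \o h) x.
Proof.
move=> hg gh hu e /hu[A hA]; exists [fset g t | t in A]%fset => B AB.
have := hA [fset h t | t in B]%fset.
rewrite big_imfset /=; last by move=> a b _ _; apply: can_inj hg a b.
apply; apply/fsubsetP => t tA; apply/imfsetP; exists (g t); last by rewrite gh.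
by apply: (fsubsetP AB); apply/imfsetP; exists t.
Qed.

Lemma null_prod (T T' : choiceType) (w : T -> R) (w' : T' -> R) :
  (forall t, 0 <= w t) -> (forall t, 0 <= w' t) -> null w -> null w' ->
  null (fun p : T * T' => w p.1 * w' p.2).
Proof.
move=> w0 w0' hw hw' e e0.
have [M M0 hM] := null_bound w0 hw; have [M' M0' hM'] := null_bound w0' hw'.
have [A hA] := hw _ (divr_gt0 e0 M0'); have [A' hA'] := hw' _ (divr_gt0 e0 M0).
exists (A `*` A')%fset => -[t t']; rewrite in_fsetM /= negb_and => /orP[/hA|/hA'].
  by rewrite ltr_pdivlMr //; apply: le_lt_trans; rewrite ler_wpM2l.
by rewrite ltr_pdivlMr //; apply: le_lt_trans; rewrite mulrC ler_wpM2l.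
Qed.

Lemma has_sum_fubini (T T' : choiceType) (w : T * T' -> F) (r : T -> F) x :
  has_sum v w x -> (forall t, has_sum v (fun t' => w (t, t')) (r t)) ->
  has_sum v r x.
Proof.
move=> hw hr e e0; have [A hA] := hw _ e0.
have [C hC] := choice (fun t => hr t _ e0).
exists [fset p.1 | p in A]%fset => B AB.
pose D := ([fset p.2 | p in A] `|` \bigcup_(t <- B) C t)%fset.
rewrite -(subrKA (\sum_(t <- B) \sum_(t' <- D) w (t, t'))); apply: nabsD_lt.
  rewrite -sumrB; apply: nabs_sum_lt => // t tB; rewrite nabsB; apply: hC.
  apply: fsubset_trans (fsubsetUr _ _).
  by apply: bigfcup_sup.
have -> : \sum_(t <- B) \sum_(t' <- D) w (t, t') = \sum_(p <- (B `*` D)%fset) w p.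
  rewrite -(big_allpairs (F := w)).
  apply: perm_big; apply: uniq_perm; rewrite ?fset_uniq //.
    by apply: allpairs_uniq; rewrite ?fset_uniq //; move=> [a b] [c d] _ _ /= [-> ->].
  move=> [t t']; rewrite in_fsetM /=; apply/allpairsP/andP.
    by move=> [[a b] /= [aB bD [-> ->]]].
  by move=> [h1 h2]; exists (t, t').
apply: hA; apply/fsubsetP => -[t t'] tA; rewrite in_fsetM /=; apply/andP; split.
  by apply: (fsubsetP AB); apply/imfsetP; exists (t, t').
by rewrite in_fsetU; apply/orP; left; apply/imfsetP; exists (t, t').
Qed.

End Summation.

Section LaurentMonomials.
Variables (F : fieldType) (n : nat).
Implicit Types (z : 'I_n -> F) (i j : 'rV[int]_n).

Lemma lmonomD z i j : (forall k, z k != 0) ->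
  lmonom z (i + j) = lmonom z i * lmonom z j.
Proof.
move=> z0; rewrite /lmonom -big_split /=; apply: eq_bigr => k _.
by rewrite mxE expfzDr.
Qed.

End LaurentMonomials.

Lemma lmonom_gt0 (R : realType) n (r : 'I_n -> {posnum R}) i :
  0 < lmonom (rnum r) i.
Proof. by rewrite /lmonom prodr_gt0 // => k _; rewrite exprz_gt0 // /rnum. Qed.

Lemma lmonom_posD (R : realType) n (r : 'I_n -> {posnum R}) i j :
  lmonom (rnum r) (i + j) = lmonom (rnum r) i * lmonom (rnum r) j.
Proof. by apply: lmonomD => k; rewrite /rnum gt_eqF. Qed.

Section Convolution.
Variables (R : realType) (F : fieldType) (v : F -> R).
Hypothesis hv : nonarch_abs v.
Variable n : nat.
Local Notation I := 'rV[int]_n.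
Variable r : 'I_n -> {posnum R}.
Implicit Types (f g h : I -> F).

Let wt f (i : I) : R := v (f i) * lmonom (rnum r) i.

Let wt_ge0 f i : 0 <= wt f i.
Proof. by rewrite /wt mulr_ge0 ?(nabs_ge0 hv) // ltW // lmonom_gt0. Qed.

Lemma l1norm_finite (N : nat) : exists A : {fset I}, forall i : I,
  i \notin A -> (N <= l1norm i)%N.
Proof.
pose dec (x : {ffun 'I_n -> 'I_(N + N).+1}) : I := \row_j ((x j)%:Z - N%:Z).
exists [fset dec x | x in {ffun 'I_n -> 'I_(N + N).+1}]%fset => i.
apply: contraNT; rewrite -ltnNge => iN.
have hj j : (`|i ord0 j| <= N)%N.
  by apply: ltnW; apply: leq_ltn_trans iN; rewrite /l1norm (bigD1 j) //= leq_addr.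
apply/imfsetP; exists [ffun j => inord (absz ((i ord0 j + N%:Z)%R))] => //.
apply/rowP => j; rewrite /dec mxE ffunE inordK.
  rewrite gez0_abs; first by rewrite addrK.
  by have := hj j; lia.
by have := hj j; lia.
Qed.

Lemma decaysP f : decays v r f <-> null (wt f).
Proof.
split=> h e e0.
  have [N hN] := h _ e0; have [A hA] := l1norm_finite N.
  by exists A => t /hA /hN.
have [A hA] := h _ e0.
exists (\sum_(i <- A) l1norm i).+1 => i iN; apply: hA.
by apply: contraTN iN => iA; rewrite -leqNgt (big_fsetD1 i) //= leq_addr.
Qed.

Lemma wt_mul f g i j : v (f j * g (i - j)) * lmonom (rnum r) i
  = wt f j * wt g (i - j).
Proof.
by rewrite /wt (nabsM hv) mulrACA -lmonom_posD subrKC.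
Qed.

Hypothesis hc : abs_complete v.

Lemma conv_has_sum f g i : decays v r f -> decays v r g ->
  has_sum v (fun j => f j * g (i - j)) (conv v f g i).
Proof.
move=> /decaysP hf /decaysP hg.
suff [x hx] : exists x, has_sum v (fun j => f j * g (i - j)) x.
  by rewrite /conv (tsumE hv hx).
apply: null_summable => //.
have hp := null_prod (wt_ge0 f) (wt_ge0 g) hf hg.
have {}hp : null ((fun p : I * I => wt f p.1 * wt g p.2) \o (fun j => (j, i - j))).
  by apply: (@null_reindex _ _ _ _ (fun p => p.1)) hp => j.
apply: (@null_le _ _ _ _ (lmonom (rnum r) i)^-1 _ _ _ hp) => [|j|j] /=.
- by rewrite invr_ge0; exact: (ltW (lmonom_gt0 r i)).
- by rewrite -wt_mul [leRHS]mulrC mulfK // gt_eqF //; exact: lmonom_gt0.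
- by rewrite mulr_ge0.
Qed.

Lemma conv_decays f g : decays v r f -> decays v r g -> decays v r (conv v f g).
Proof.
move=> df dg; apply/decaysP => e e0.
have e2 : 0 < e / 2 by rewrite divr_gt0.
have [/decaysP hf /decaysP hg] := (df, dg).
have [A hA] := null_prod (wt_ge0 f) (wt_ge0 g) hf hg e2.
exists [fset (p.1 + p.2)%R | p in A]%fset => i iA.
apply: (@le_lt_trans _ _ (e / 2)); last by rewrite gtr_pMr // invf_lt1 ?ltr1n.
rewrite /wt -ler_pdivlMr ?lmonom_gt0 //.
apply: (has_sum_le hv _ (conv_has_sum i df dg)) => [|j].
  by rewrite divr_ge0 ?ltW // lmonom_gt0.
rewrite ler_pdivlMr ?lmonom_gt0 // wt_mul; apply/ltW/(hA (j, i - j)).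
by apply: contra iA => jA; apply/imfsetP; exists (j, i - j) => //=; rewrite addrC subrK.
Qed.

Lemma convA_K f g h : decays v r f -> decays v r g -> decays v r h ->
  conv v (conv v f g) h = conv v f (conv v g h).
Proof.
move=> df dg dh; apply/funext => k.
pose w (p : I * I) := f p.2 * g (p.1 - p.2) * h (k - p.1).
have [/decaysP hf /decaysP hg /decaysP hh] := And3 df dg dh.
have [M M0 hM] := null_bound (wt_ge0 h) hh.
have [x hx] : exists x, has_sum v w x.
  apply: null_summable => //.
  have hp := null_prod (wt_ge0 f) (wt_ge0 g) hf hg.
  pose phi (p : I * I) := (p.2, p.1 - p.2).
  have {}hp : null ((fun p : I * I => wt f p.1 * wt g p.2) \o phi).
    apply: (@null_reindex _ _ _ _ (fun p => (p.1 + p.2, p.1))) hp => -[a b] /=.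
    by rewrite addrC subrK.
  apply: null_le hp; first exact: (ltW (divr_gt0 M0 (lmonom_gt0 r k))).
    move=> [a b] /=; rewrite mulrAC ler_pdivlMr ?lmonom_gt0 //.
    have -> : v (w (a, b)) * lmonom (rnum r) k
        = v (f b * g (a - b)) * lmonom (rnum r) a * wt h (k - a).
      by rewrite /w /= (nabsM hv) /wt [RHS]mulrACA -lmonom_posD subrKC.
    by rewrite wt_mul [leRHS]mulrC ler_wpM2l // mulr_ge0.
  by move=> p /=; rewrite mulr_ge0.
have h1 : has_sum v (fun i => conv v f g i * h (k - i)) x.
  apply: (has_sum_fubini hv hx) => i; exact: (has_sumZr hv (h (k - i)) (conv_has_sum i df dg)).
have h2 : has_sum v (fun j => f j * conv v g h (k - j)) x.
  have hx' : has_sum v (w \o (fun p => (p.2, p.1))) x.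
    by apply: (@has_sum_reindex _ _ _ _ _ _ (fun p => (p.2, p.1))) hx => -[].
  apply: (has_sum_fubini hv hx') => j.
  have /(has_sumZ hv (f j)) := conv_has_sum (k - j) dg dh.
  move/(@has_sum_reindex _ _ _ _ _ (fun i => i - j) (fun i => i + j)) => /(_ (subrK _) (addrK _)).
  apply: eq_has_sum => i /=; rewrite /w /= mulrA opprB addrA subrK //.
by rewrite /conv (tsumE hv h1) (tsumE hv h2).
Qed.

Lemma convC f g : decays v r f -> decays v r g -> conv v f g = conv v g f.
Proof.
move=> df dg; apply/funext => i.
have := conv_has_sum i df dg.
move/(@has_sum_reindex _ _ _ _ _ (fun j => i - j) (fun j => i - j)).
have ii : cancel (fun j : I => i - j) (fun j => i - j) by move=> j; rewrite subKr.
move=> /(_ ii ii) h; rewrite [RHS](tsumE hv (x := conv v f g i)) //.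
by apply: eq_has_sum h => j /=; rewrite subKr mulrC.
Qed.

Lemma unit_decays c : decays v r (unit_series c).
Proof.
move=> e e0; exists 1%N => i i0; rewrite /unit_series ifN ?nabs0 ?mul0r //.
apply: contraTneq i0 => ->; rewrite /l1norm big1 // => j _.
by rewrite mxE absz0.
Qed.

Lemma conv_unit c f i : conv v (unit_series c) f i = c * f i.
Proof.
apply: (tsumE hv) => e e0; exists [fset 0]%fset => B.
rewrite fsub1set => B0; rewrite (big_fsetD1 0) //= /unit_series eqxx subr0.
rewrite big1_fset ?addr0 ?subrr ?nabs0 // => j; rewrite !inE => /andP[/negPf-> _] _.
by rewrite mul0r.
Qed.

End Convolution.

(* absKbar is the (unique) extension of absK to the algebraic closure fKbar. *)
Record padic_setting (R : realType) := PadicSetting {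
  prm : nat;
  prm_prime : prime prm;
  fK : fieldType;
  absK : fK -> R;
  absK_nonarch : nonarch_abs absK;
  absK_complete : abs_complete absK;
  fK_char0 : [pchar fK] =i pred0;
  absK_prm : absK prm%:R = prm%:R^-1;
  fKbar : closedFieldType;
  emb : {rmorphism fK -> fKbar};
  emb_algebraic : forall x : fKbar, algebraicOver emb x;
  absKbar : fKbar -> R;
  absKbar_nonarch : nonarch_abs absKbar;
  absKbar_emb : forall a : fK, absKbar (emb a) = absK a }.

Section Gamma.
Variables (R : realType) (S : padic_setting R).
Local Notation p := (prm S).
Local Notation K := (fK S).
Local Notation Kb := (fKbar S).

(* The smallest subfield of the algebraic closure containing K and all p^s-th
   roots of unity. *)
Definition in_KGamma : {pred Kb} := fun x =>
  `[< forall E : {pred Kb}, GRing.divring_closed E ->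
      (forall a : K, emb S a \in E) ->
      (forall (s : nat) (z : Kb), (p ^ s).-unity_root z -> z \in E) ->
      x \in E >].

Lemma in_KGamma_divring : GRing.divring_closed in_KGamma.
Proof.
split.
- by apply/asboolP => E [].
- move=> x y /asboolP hx /asboolP hy; apply/asboolP => E hE hK hG.
  by have [_ hB _] := hE; apply: hB; [apply: hx|apply: hy].
- move=> x y /asboolP hx /asboolP hy; apply/asboolP => E hE hK hG.
  by have [_ _ hB] := hE; apply: hB; [apply: hx|apply: hy].
Qed.
HB.instance Definition _ :=
  GRing.isDivringClosed.Build Kb in_KGamma in_KGamma_divring.

Record KGamma := MkKGamma { KGval : Kb; KGvalP : KGval \in in_KGamma }.
HB.instance Definition _ := [isSub for KGval].
HB.instance Definition _ := [Choice of KGamma by <:].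
HB.instance Definition _ := [SubChoice_isSubIntegralDomain of KGamma by <:].
HB.instance Definition _ := [SubIntegralDomain_isSubField of KGamma by <:].

Lemma emb_in_KGamma (a : K) : emb S a \in in_KGamma.
Proof. by apply/asboolP => E _ hK _. Qed.

Definition embG (a : K) : KGamma := MkKGamma (emb_in_KGamma a).

Lemma embG_zmod_morphism : zmod_morphism embG.
Proof. by move=> a b; apply: val_inj; rewrite /= !rmorphB. Qed.
Lemma embG_monoid_morphism : monoid_morphism embG.
Proof.
by split=> [|a b]; apply: val_inj; rewrite /= ?rmorph1 ?rmorphM.
Qed.
HB.instance Definition _ :=
  GRing.isZmodMorphism.Build K KGamma embG embG_zmod_morphism.
HB.instance Definition _ :=
  GRing.isMonoidMorphism.Build K KGamma embG embG_monoid_morphism.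

Definition absG (x : KGamma) : R := absKbar (KGval x).

Lemma absG_nonarch : nonarch_abs absG.
Proof.
have [h1 h2 h3 h4] := absKbar_nonarch S.
split=> [x|x|x y|x y]; rewrite /absG //=.
split; first by move/h2 => h; apply: val_inj.
by move=> ->; apply/h2.
Qed.

Lemma absG_embG a : absG (embG a) = absK a.
Proof. exact: absKbar_emb. Qed.

Definition inGamma_s (n s : nat) (z : 'I_n -> KGamma) : Prop :=
  forall j, (p ^ s).-unity_root (z j).

Definition inGamma (n : nat) (z : 'I_n -> KGamma) : Prop :=
  forall j, exists2 s : nat, (0 < s)%N & (p ^ s).-unity_root (z j).

End Gamma.

Section Rings.
Variables (R : realType) (S : padic_setting R) (n : nat).
Local Notation p := (prm S).
Local Notation K := (fK S).
Local Notation KG := (KGamma S).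
Local Notation I := 'rV[int]_n.
Local Notation radius := ('I_n -> {posnum R}).
Local Notation aK := (@absK R S).
Local Notation aG := (@absG R S).
Implicit Types (a b r : radius).

Definition polysegment a b : set radius :=
  [set r | forall j, (a j)%:num <= (r j)%:num <= (b j)%:num].

Definition interior a b : set radius :=
  [set r | forall j, (a j)%:num < (r j)%:num < (b j)%:num].

Definition convergent a b (g : I -> K) : Prop :=
  forall r, polysegment a b r -> decays aK r g.

(* The image of K_{J,n}, J = [a, b], among the Laurent series with coefficients in
   K(Gamma). *)
Definition KJ a b : set (I -> KG) :=
  [set f | exists2 g : I -> K, convergent a b g & f = (fun i => embG (g i))].

Definition span_series (s : seq (KG * (I -> K))) : I -> KG :=
  fun i => \sum_(x <- s) x.1 * embG (x.2 i).

(* The tensor product of K_{J,n} and K(Gamma) over K, identified with its image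
   under the injective map to Laurent series sending (f, c) to c f. *)
Definition KJG a b : set (I -> KG) :=
  [set f | exists2 s, (forall x, x \in s -> convergent a b x.2) &
                      f = span_series s].

Section Rho.
Variable rho : radius.

Definition in_RGam : {pred I -> KG} := fun f =>
  `[< exists a b, interior a b rho /\ KJG a b f >].

Lemma interior_nonempty : exists a b, interior a b rho.
Proof.
exists (fun j => ((rho j)%:num / 2)%:pos), (fun j => ((rho j)%:num + 1)%:pos).
by move=> j /=; rewrite ltrDl ltr01 gtr_pMr // invf_lt1 ?ltr1n.
Qed.

Lemma interiorS a b : interior a b rho -> polysegment a b rho.
Proof. by move=> h j; have /andP[/ltW-> /ltW->] := h j. Qed.

Definition conv_rho (g : I -> K) : Prop :=
  exists a b, interior a b rho /\ convergent a b g.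

Lemma conv_rho_decays g : conv_rho g -> decays aK rho g.
Proof. by move=> [a [b [h hg]]]; apply/hg/interiorS. Qed.

Lemma common_interior (s : seq (KG * (I -> K))) :
  (forall x, x \in s -> conv_rho x.2) ->
  exists a b, interior a b rho /\ (forall x, x \in s -> convergent a b x.2).
Proof.
elim: s => [|x s IH] h.
  by have [a [b hab]] := interior_nonempty; exists a, b.
have [|a [b [hab hs]]] := IH.
  by move=> y ys; apply: h; rewrite inE ys orbT.
have [a' [b' [hab' hx]]] := h x (mem_head _ _).
exists (fun j => if (a j)%:num <= (a' j)%:num then a' j else a j).
exists (fun j => if (b j)%:num <= (b' j)%:num then b j else b' j).
split.
  by move=> j; have := hab j; have := hab' j; case: ifP; case: ifP => _ _;
    by move=> /andP[h1 h2] /andP[h3 h4]; rewrite ?h1 ?h2 ?h3 ?h4.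
move=> y; rewrite inE => /predU1P[->|/hs hy] r hr; [apply: hx|apply: hy] => j;
  have /andP[] := hr j.
  case: (leP (a j)%:num (a' j)%:num) => h1; case: (leP (b j)%:num (b' j)%:num) => h2 h3 h4.
  - by rewrite h3 (le_trans h4).
  - by rewrite h3.
  - by rewrite (le_trans (ltW h1)) // (le_trans h4).
  - by rewrite (le_trans (ltW h1)).
case: (leP (a j)%:num (a' j)%:num) => h1; case: (leP (b j)%:num (b' j)%:num) => h2 h3 h4.
- by rewrite (le_trans h1).
- by rewrite (le_trans h1) // (le_trans h4) // ltW.
- by rewrite h3.
- by rewrite h3 (le_trans h4) // ltW.
Qed.

Lemma in_RGamP (f : I -> KG) : reflect
  (exists2 s, (forall x, x \in s -> conv_rho x.2) & f = span_series s)
  (f \in in_RGam).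
Proof.
apply: (iffP (asboolP (exists a b, interior a b rho /\ KJG a b f))).
  move=> [a [b [hab [s hs ->]]]].
  by exists s => // x /hs hx; exists a, b.
move=> [s hs ->].
by have [a [b [hab h]]] := common_interior hs; exists a, b; split=> //; exists s.
Qed.

Lemma span_series_cat s t :
  span_series (s ++ t) = (fun i => span_series s i + span_series t i).
Proof. by apply/funext => i; rewrite /span_series big_cat. Qed.

Lemma span_series_opp s : span_series [seq (- x.1, x.2) | x <- s] =
  (fun i => - span_series s i).
Proof.
apply/funext => i; rewrite /span_series big_map -sumrN.
by apply: eq_bigr => x _; rewrite mulNr.
Qed.

Lemma in_RGam_zmod : zmod_closed in_RGam.
Proof.
split.
  by apply/in_RGamP; exists [::] => //; apply/funext => i; rewrite /span_series big_nil.
move=> f g /in_RGamP[s hs ->] /in_RGamP[t ht ->]; apply/in_RGamP.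
exists (s ++ [seq (- x.1, x.2) | x <- t]).
  by move=> x; rewrite mem_cat => /orP[/hs //|/mapP[y /ht hy ->]].
by rewrite span_series_cat span_series_opp.
Qed.
HB.instance Definition _ :=
  GRing.isZmodClosed.Build (I -> KG) in_RGam in_RGam_zmod.

Definition mul_span (s t : seq (KG * (I -> K))) : seq (KG * (I -> K)) :=
  [seq (x.1 * y.1, conv aK x.2 y.2) | x <- s, y <- t].

Lemma conv_rho_conv f g : conv_rho f -> conv_rho g -> conv_rho (conv aK f g).
Proof.
move=> hf hg.
have [|a [b [hab h]]] := @common_interior [:: (0, f); (0, g)].
  by move=> x; rewrite !inE => /orP[] /eqP ->.
exists a, b; split=> // r hr; apply: conv_decays.
- exact: absK_nonarch.
- exact: absK_complete.
- by apply: (h (0, f)); rewrite ?mem_head.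
- by apply: (h (0, g)); rewrite // !inE eqxx orbT.
Qed.

Lemma has_sum_embG (T : choiceType) (u : T -> K) x :
  has_sum aK u x -> has_sum aG (fun t => embG (u t)) (embG x).
Proof.
move=> h e /h[A hA]; exists A => B /hA.
by rewrite -absG_embG rmorphB rmorph_sum.
Qed.

Lemma conv_span s t :
  (forall x, x \in s -> conv_rho x.2) -> (forall x, x \in t -> conv_rho x.2) ->
  conv aG (span_series s) (span_series t) = span_series (mul_span s t).
Proof.
move=> hs ht; apply/funext => i.
rewrite /span_series /mul_span big_allpairs_dep /=.
apply: tsumE; first exact: absG_nonarch.
have hsum x y : x \in s -> y \in t ->
    has_sum aG (fun j => x.1 * embG (x.2 j) * (y.1 * embG (y.2 (i - j))))
      (x.1 * y.1 * embG (conv aK x.2 y.2 i)).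
  move=> xs yt.
  have /has_sum_embG h := conv_has_sum (absK_nonarch S) (@absK_complete _ S) i
     (conv_rho_decays (hs _ xs)) (conv_rho_decays (ht _ yt)).
  apply: eq_has_sum (has_sumZ (absG_nonarch S) (x.1 * y.1) h) => j.
  by rewrite rmorphM mulrACA.
have hsum' x y : has_sum aG
    (fun j => if (x \in s) && (y \in t) then
       x.1 * embG (x.2 j) * (y.1 * embG (y.2 (i - j))) else 0)
      (if (x \in s) && (y \in t) then
         x.1 * y.1 * embG (conv aK x.2 y.2 i) else 0).
  case: ifP => [/andP[xs yt]|_]; first exact: hsum.
  exact/has_sum0/absG_nonarch.
have h := has_sum_big (absG_nonarch S) s (fun x => has_sum_big (absG_nonarch S) t (hsum' x)).
have -> : \sum_(x <- s) \sum_(y <- t) x.1 * y.1 * embG (conv aK x.2 y.2 i) =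
  \sum_(x <- s) \sum_(y <- t) (if (x \in s) && (y \in t) then
         x.1 * y.1 * embG (conv aK x.2 y.2 i) else 0).
  by apply: eq_big_seq => x xs; apply: eq_big_seq => y yt; rewrite xs yt.
apply: eq_has_sum h => j; rewrite mulr_suml; apply: eq_big_seq => x xs.
by rewrite mulr_sumr; apply: eq_big_seq => y yt; rewrite xs yt.
Qed.

Lemma mul_spanP s t :
  (forall x, x \in s -> conv_rho x.2) -> (forall x, x \in t -> conv_rho x.2) ->
  forall x, x \in mul_span s t -> conv_rho x.2.
Proof.
move=> hs ht z /allpairsP[[x y] /= [xs yt ->]] /=.
by apply: conv_rho_conv; [apply: hs|apply: ht].
Qed.

Lemma in_RGam_conv f g : f \in in_RGam -> g \in in_RGam ->
  conv aG f g \in in_RGam.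
Proof.
move=> /in_RGamP[s hs ->] /in_RGamP[t ht ->]; apply/in_RGamP.
by exists (mul_span s t); [exact: mul_spanP|rewrite conv_span].
Qed.

Lemma unit_conv_rho c : conv_rho (unit_series c).
Proof.
have [a [b h]] := interior_nonempty; exists a, b; split=> // r _.
exact/unit_decays/absK_nonarch.
Qed.

Lemma unit_series_span c : unit_series c = span_series [:: (c, unit_series 1)].
Proof.
apply/funext => i; rewrite /span_series big_seq1 /unit_series /=.
by case: eqP => _; rewrite ?rmorph1 ?rmorph0 ?mulr1 ?mulr0.
Qed.

Lemma in_RGam_unit c : unit_series c \in in_RGam.
Proof.
apply/in_RGamP; exists [:: (c, unit_series 1)]; last exact: unit_series_span.
by move=> x; rewrite inE => /eqP->; exact: unit_conv_rho.
Qed.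

(* The tensor product of R_rho and K(Gamma) over K, see RGam_tensor. *)
Record RGam := MkRGam { RGcoef :> I -> KG; RGcoefP : RGcoef \in in_RGam }.
HB.instance Definition _ := [isSub for RGcoef].
HB.instance Definition _ := [Choice of RGam by <:].
HB.instance Definition _ := [SubChoice_isSubZmodule of RGam by <:].

Definition RGconst (c : KG) : RGam := MkRGam (in_RGam_unit c).

Definition RGmul (f g : RGam) : RGam := MkRGam (in_RGam_conv (RGcoefP f) (RGcoefP g)).

Lemma RGmulA : associative RGmul.
Proof.
move=> [f hf] [g hg] [h hh]; apply: val_inj => /=.
case/in_RGamP: hf => s hs ->; case/in_RGamP: hg => t ht ->.
case/in_RGamP: hh => w hw ->.
rewrite (conv_span ht hw) (conv_span hs ht) !conv_span //; try exact: mul_spanP.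
apply/funext => i; rewrite /span_series /mul_span !big_allpairs_dep /=.
apply: eq_big_seq => x xs; rewrite big_allpairs_dep; apply: eq_big_seq => y yt.
apply: eq_big_seq => z zw /=; rewrite mulrA.
rewrite (convA_K (absK_nonarch S) (@absK_complete _ S)
  (conv_rho_decays (hs _ xs)) (conv_rho_decays (ht _ yt))) //.
exact: (conv_rho_decays (hw _ zw)).
Qed.

Lemma RGmulC : commutative RGmul.
Proof.
move=> [f hf] [g hg]; apply: val_inj => /=.
case/in_RGamP: hf => s hs ->; case/in_RGamP: hg => t ht ->.
rewrite !conv_span //; apply/funext => i.
rewrite /span_series /mul_span !big_allpairs_dep /= exchange_big /=.
apply: eq_big_seq => y yt; apply: eq_big_seq => x xs /=; rewrite mulrC.
by rewrite mulrC [y.1 * _]mulrC (convC (absK_nonarch S) (@absK_complete _ S)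
  (conv_rho_decays (hs _ xs)) (conv_rho_decays (ht _ yt))) mulrC.
Qed.

Lemma RGmul1 : left_id (RGconst 1) RGmul.
Proof.
move=> f; apply: val_inj; apply/funext => i /=.
by rewrite conv_unit ?mul1r //; exact: absG_nonarch.
Qed.

Lemma RGmulDl : left_distributive RGmul +%R.
Proof.
move=> [f hf] [g hg] [h hh]; apply: val_inj => /=.
case/in_RGamP: hf => s hs ->; case/in_RGamP: hg => t ht ->.
case/in_RGamP: hh => w hw ->.
rewrite -[span_series s + span_series t]/(fun i => span_series s i + span_series t i).
rewrite -span_series_cat !conv_span // /mul_span; last first.
  by move=> x; rewrite mem_cat => /orP[/hs|/ht].
by rewrite map_cat flatten_cat span_series_cat.
Qed.

Lemma RGone_neq0 : RGconst 1 != 0.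
Proof.
apply/eqP => /(congr1 (fun f : RGam => RGcoef f 0)) /=.
by rewrite /unit_series eqxx => /eqP; rewrite oner_eq0.
Qed.

HB.instance Definition _ := GRing.Zmodule_isComNzRing.Build RGam
  RGmulA RGmulC RGmul1 RGmulDl RGone_neq0.

(* f(z t); the default value 0 is not used for z in Gamma^n, see zstarE. *)
Definition zstar (z : 'I_n -> KG) (f : RGam) : RGam :=
  insubd 0 (fun i => lmonom z i * f i).

Lemma inGamma_level (z : 'I_n -> KG) : inGamma z -> exists s, inGamma_s s z.
Proof.
move=> h; have [s hs] := choice (fun j => let: ex_intro2 s _ e := h j in ex_intro _ s e).
exists (\sum_j s j)%N => j; rewrite (bigD1 j) //= expnD.
have := hs j; rewrite !unity_rootE => /eqP e.
by rewrite exprM e expr1n.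
Qed.

Lemma lmonom_mod (z : 'I_n -> KG) (q : nat) (i : I) : (0 < q)%N ->
  (forall j, z j ^+ q = 1) ->
  lmonom z i = \prod_j z j ^+ absz (modz (i ord0 j) q).
Proof.
move=> q0 hz; apply: eq_bigr => j _.
have z0 : z j != 0.
  apply: contra_eq_neq (hz j) => ->; rewrite expr0n eqn0Ngt q0 /=.
  by rewrite eq_sym oner_neq0.
rewrite {1}(divz_eq (i ord0 j) q) expfzDr // [X in z j ^ X * _]mulrC -exprz_exp.
rewrite -exprnP hz exp1rz mul1r exprnP gez0_abs // modz_ge0 //.
by rewrite -lt0n.
Qed.

Lemma zstarE (z : 'I_n -> KG) (f : RGam) : inGamma z ->
  forall i, zstar z f i = lmonom z i * f i.
Proof.
move=> /inGamma_level[s hs] i; rewrite /zstar /= insubdK //.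
have [Q eQ] : exists Q, (p ^ s)%N = Q.+1.
  by exists (p ^ s).-1; rewrite prednK // expn_gt0 prime_gt0 // prm_prime.
have hz j : z j ^+ Q.+1 = 1 by have := hs j; rewrite unity_rootE eQ => /eqP.
pose md (k : I) : {ffun 'I_n -> 'I_Q.+1} :=
  [ffun j => inord (absz (modz (k ord0 j) Q.+1))].
have mdE k j : nat_of_ord (md k j) = absz (modz (k ord0 j) Q.+1).
  by rewrite ffunE inordK //; have := ltz_pmod (k ord0 j) (isT : 0 < Q.+1%:Z); 
     have := modz_ge0 (k ord0 j) (isT : Q.+1%:Z != 0); lia.
have [/in_RGamP[t ht ef]] := (RGcoefP f); apply/in_RGamP.
exists [seq (\prod_j z j ^+ m j * x.1, fun k => if md k == m then x.2 k else 0)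
        | m : {ffun 'I_n -> 'I_Q.+1} <- enum {ffun 'I_n -> 'I_Q.+1}, x <- t].
  move=> y /allpairsP[[m x] /= [_ /ht[a [b [hab hx]]] ->]].
  exists a, b; split=> // r hr e e0; have [N hN] := hx r hr e e0.
  exists N => k /hN /=; case: ifP => // _ _.
  by rewrite nabs0 ?mul0r //; exact: absK_nonarch.
apply/funext => k; rewrite ef /span_series big_allpairs_dep /= big_enum /=.
rewrite (bigD1 (md k)) //= [X in _ + X]big1 ?addr0 => [|m mk].
  rewrite (lmonom_mod k (ltn0Sn Q) hz) mulr_sumr; apply: eq_bigr => x _.
  rewrite eqxx mulrA; congr (_ * _ * _); apply: eq_bigr => j _.
  by rewrite mdE.
rewrite big1 // => x _; rewrite eq_sym (negPf mk) rmorph0 mulr0 //.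
Qed.

Definition in_Rrho : {pred RGam} := fun f =>
  `[< exists a b, interior a b rho /\ KJ a b f >].

Lemma in_RrhoP (f : RGam) : reflect
  (exists2 g, conv_rho g & RGcoef f = span_series [:: (1, g)]) (f \in in_Rrho).
Proof.
have e g : span_series [:: (1, g)] = fun i => embG (g i).
  by apply/funext => i; rewrite /span_series big_seq1 mul1r.
apply: (iffP (asboolP (exists a b, interior a b rho /\ KJ a b f))).
  move=> [a [b [hab [g hg ->]]]].
  by exists g; rewrite ?e //; exists a, b.
move=> [g [a [b [hab hg]]] ->].
by exists a, b; split=> //; exists g.
Qed.

Lemma in_Rrho_subring : subring_closed in_Rrho.
Proof.
split.
- apply/in_RrhoP; exists (unit_series 1); first exact: unit_conv_rho.
  by rewrite -unit_series_span.
- move=> f g /in_RrhoP[u hu ef] /in_RrhoP[w hw eg]; apply/in_RrhoP.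
  exists (fun i => u i - w i).
    have [|a [b [hab h]]] := @common_interior [:: (0, u); (0, w)].
      by move=> x; rewrite !inE => /orP[] /eqP ->.
    exists a, b; split=> // r hr e e0.
    have [|N hN] := h (0, u) _ r hr _ e0; first by rewrite mem_head.
    have [|M hM] := h (0, w) _ r hr _ e0; first by rewrite !inE eqxx orbT.
    exists (maxn N M) => i; rewrite geq_max => /andP[iN iM].
    rewrite -ltr_pdivlMr ?lmonom_gt0 //.
    have hv := absK_nonarch S.
    by apply: nabsD_lt => //; rewrite ?nabsN // ltr_pdivlMr ?lmonom_gt0 ?hN ?hM.
  rewrite /= ef eg; apply/funext => i; rewrite /span_series.
  by rewrite [LHS]/GRing.add /= /GRing.opp /= !big_seq1 /= !mul1r rmorphB.
- move=> f g /in_RrhoP[u hu ef] /in_RrhoP[w hw eg]; apply/in_RrhoP.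
  exists (conv aK u w); first exact: conv_rho_conv.
  rewrite /= ef eg conv_span /mul_span /= ?mulr1 //.
    by move=> x; rewrite inE => /eqP ->.
  by move=> x; rewrite inE => /eqP ->.
Qed.
HB.instance Definition _ :=
  GRing.isSubringClosed.Build RGam in_Rrho in_Rrho_subring.

Record Rrho := MkRrho { Rval :> RGam; RvalP : Rval \in in_Rrho }.
HB.instance Definition _ := [isSub for Rval].
HB.instance Definition _ := [Choice of Rrho by <:].
HB.instance Definition _ := [SubChoice_isSubComNzRing of Rrho by <:].

Lemma in_Rrho_const (a : K) : RGconst (embG a) \in in_Rrho.
Proof.
apply/in_RrhoP; exists (unit_series a); first exact: unit_conv_rho.
apply/funext => i; rewrite /span_series big_seq1 /= mul1r /unit_series.
by case: eqP; rewrite ?rmorph0.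
Qed.

Definition Rconst (a : K) : Rrho := MkRrho (in_Rrho_const a).

End Rho.
End Rings.

Definition balanced_map (A : Type) (V W T : zmodType) (aV : A -> V -> V)
    (aW : A -> W -> W) (t : V -> W -> T) : Prop :=
  [/\ forall w, zmod_morphism (t^~ w),
      forall x, zmod_morphism (t x) &
      forall a x w, t (aV a x) w = t x (aW a w)].

(* The universal property of the tensor product over A. *)
Definition is_tensor (A : Type) (V W T : zmodType) (aV : A -> V -> V)
    (aW : A -> W -> W) (t : V -> W -> T) : Prop :=
  balanced_map aV aW t /\
  forall (U : zmodType) (b : V -> W -> U), balanced_map aV aW b ->
    (exists phi : {additive T -> U}, forall x w, phi (t x w) = b x w) /\
    (forall phi psi : {additive T -> U},
       (forall x w, phi (t x w) = psi (t x w)) -> phi =1 psi).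

(* X is the span of e over the subring B, and e is free over B. *)
Definition is_basis (A : pzRingType) (M : lmodType A) (B : set A) (X : set M)
    (m : nat) (e : 'I_m -> M) : Prop :=
  (forall c : 'rV[A]_m, (forall i, B (c ord0 i)) ->
     X (\sum_(i < m) c ord0 i *: e i)) /\
  (forall x, X x -> exists! c : 'rV[A]_m,
     (forall i, B (c ord0 i)) /\ x = \sum_(i < m) c ord0 i *: e i).

Section RGamTensor.
Variables (R : realType) (S : padic_setting R) (n : nat).
Variable rho : 'I_n -> {posnum R}.
Local Notation K := (fK S).
Local Notation KG := (KGamma S).
Local Notation Rr := (Rrho S rho).
Local Notation RG := (RGam S rho).

Lemma RGam_ext (f g : RG) : (forall i, f i = g i) -> f = g.
Proof. by move=> h; apply: val_inj; apply/funext. Qed.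

Lemma RGconstE (c : KG) (f : RG) i : (RGconst rho c * f) i = c * f i.
Proof. exact: (conv_unit (absG_nonarch S)). Qed.

Definition comb (s : seq (KG * Rr)) : RG :=
  \sum_(x <- s) RGconst rho x.1 * Rval x.2.

Lemma combE s i : comb s i = \sum_(x <- s) x.1 * (Rval x.2) i.
Proof.
rewrite /comb; elim: s => [|x s IH]; first by rewrite !big_nil.
by rewrite !big_cons -RGconstE -IH.
Qed.

Lemma Rrho_coef (g : Rr) i : exists a : K, Rval g i = embG a.
Proof.
have /asboolP [a [b [_ [h _ ->]]]] := RvalP g.
by exists (h i).
Qed.

Lemma RGam_comb (f : RG) : exists s, f = comb s.
Proof.
have /in_RGamP[t] := RGcoefP f; case: f => f hf /= ht ef.
elim: t f hf ht ef => [|[c g] t IH] f hf ht ef.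
  exists [::]; apply: val_inj; rewrite /= ef /comb big_nil.
  by apply/funext => i; rewrite /span_series big_nil.
have hg : conv_rho rho g by apply: (ht (c, g)); rewrite mem_head.
have hG : span_series [:: (1 : KG, g)] \in in_RGam rho.
  by apply/in_RGamP; exists [:: (1, g)] => // x; rewrite inE => /eqP ->.
have hR : MkRGam hG \in @in_Rrho _ _ _ rho by apply/in_RrhoP; exists g.
have ht' x : x \in t -> conv_rho rho x.2.
  by move=> xt; apply: ht; rewrite inE xt orbT.
have hT : span_series t \in in_RGam rho by apply/in_RGamP; exists t.
have [s es] := IH _ hT ht' erefl.
exists ((c, MkRrho hR) :: s); rewrite /comb big_cons -/(comb s) -es.
apply: val_inj; apply/funext => i.
rewrite -[RHS]/((RGconst rho c * MkRGam hG) i + span_series t i) RGconstE /=.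
by rewrite ef /span_series big_cons big_seq1 mul1r.
Qed.

Lemma RGam_tensor :
  is_tensor (fun (a : K) (x : Rr) => Rconst rho a * x)
            (fun (a : K) (c : KG) => embG a * c)
            (fun (x : Rr) (c : KG) => RGconst rho c * Rval x).
Proof.
split.
  split.
  - by move=> c x y; rewrite -mulrBr.
  - move=> x c d; apply: RGam_ext => i.
    rewrite -[RHS]/((RGconst rho c * Rval x) i - (RGconst rho d * Rval x) i).
    by rewrite !RGconstE mulrBl.
  - move=> a x c; apply: RGam_ext => i.
    rewrite -[LHS]/((RGconst rho c * (RGconst rho (embG a) * Rval x)) i).
    by rewrite !RGconstE mulrCA mulrA.
move=> U b [bl br bb].
have b0l c : b 0 c = 0 by rewrite -{1}(subrr 0) bl subrr.
have b0r x : b x 0 = 0 by rewrite -{1}(subrr 0) br subrr.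
have bN x c : b x (- c) = - b x c by rewrite -sub0r br b0r sub0r.
have bD x c d : b x (c + d) = b x c + b x d by rewrite -{1}[d]opprK br bN opprK.
have b_sum x s : b x (\sum_(y <- s) y) = \sum_(y <- s) b x y.
  elim: s => [|y s IH]; last by rewrite !big_cons bD IH.
  by rewrite !big_nil.
pose B (s : seq (KG * Rr)) := \sum_(x <- s) b x.2 x.1.
have B0 s : comb s = 0 -> B s = 0.
  have [N] := ubnP (size s); elim: N s => // N IH [|[c g] s] /=.
    by rewrite /B big_nil.
  rewrite ltnS => sN e0.
  have ei i : c * Rval g i + \sum_(x <- s) x.1 * Rval x.2 i = 0.
    have := congr1 (fun f : RG => f i) e0.
    by rewrite combE big_cons.
  have [g0|/existsNP[i gi]] := pselect (forall i, Rval g i = 0).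
    have -> : B ((c, g) :: s) = B s.
      rewrite /B big_cons /=; suff -> : g = 0 by rewrite b0l add0r.
      by apply: val_inj; apply: val_inj; apply/funext.
    apply: IH => //; apply: RGam_ext => i; rewrite combE.
    by have := ei i; rewrite g0 mulr0 add0r.
  have [a ea] := Rrho_coef g i.
  have a0 : a != 0 by apply/eqP => a0; apply: gi; rewrite ea a0 rmorph0.
  have [l hl] := choice (fun x : Rr => Rrho_coef x i).
  pose s' := [seq (x.1, x.2 - Rconst rho (l x.2 / a) * g) | x <- s].
  have ec : c = \sum_(y <- [seq - (embG (l x.2 / a) * x.1) | x <- s]) y.
    apply: (mulIf (x := embG a)); first by rewrite fmorph_eq0.
    rewrite -ea; have /eqP := ei i; rewrite addr_eq0 => /eqP ->.
    rewrite big_map sumrN mulNr; congr (- _); rewrite mulr_suml.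
    apply: eq_bigr => x _; rewrite hl ea fmorph_div mulrAC divfK ?fmorph_eq0 //.
    by rewrite mulrC.
  have -> : B ((c, g) :: s) = B s'.
    rewrite /B big_cons big_map /= {1}ec b_sum big_map -big_split /=.
    apply: eq_bigr => x _; rewrite bN bl addrC; congr (_ - _).
    by rewrite bb.
  apply: IH; first by rewrite size_map.
  apply: RGam_ext => k; rewrite combE big_map /=.
  transitivity (\sum_(x <- s) (x.1 * Rval x.2 k - embG (l x.2 / a) * x.1 * Rval g k)).
    apply: eq_bigr => x _.
    rewrite -[X in _ * X]/(Rval x.2 k - (RGconst rho (embG (l x.2 / a)) * Rval g) k).
    by rewrite RGconstE mulrBr mulrCA mulrA.
  rewrite sumrB -mulr_suml; apply: etrans (ei k).
  by rewrite {1}ec big_map sumrN mulNr addrC.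
have [rep hrep] := choice RGam_comb.
have catB s t : B (s ++ t) = B s + B t by rewrite /B big_cat.
have catC s t : comb (s ++ t) = comb s + comb t by rewrite /comb big_cat.
pose neg (s : seq (KG * Rr)) := [seq (- x.1, x.2) | x <- s].
have negB s : B (neg s) = - B s.
  by rewrite /B big_map -sumrN; apply: eq_bigr => x _; rewrite /= bN.
have negC s : comb (neg s) = - comb s.
  apply: RGam_ext => i; rewrite -[RHS]/(- (comb s i)) !combE.
  by rewrite big_map -sumrN; apply: eq_bigr => x _; rewrite /= mulNr.
have Beq s t : comb s = comb t -> B s = B t.
  move=> e; apply/eqP; rewrite -subr_eq0 -negB -catB; apply/eqP/B0.
  by rewrite catC negC e subrr.
have phiP : zmod_morphism (fun f => B (rep f)).
  move=> f g; rewrite -negB -catB; apply: Beq.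
  by rewrite catC negC -!hrep.
split.
  pose phi : {additive RG -> U} := HB.pack (fun f => B (rep f))
    (GRing.isZmodMorphism.Build _ _ _ phiP).
  exists phi => x c.
  have -> : b x c = B [:: (c, x)] by rewrite /B big_seq1.
  by apply: Beq; rewrite -hrep /comb big_seq1.
move=> phi psi h f; have [s ->] := RGam_comb f.
by rewrite !raddf_sum; apply: eq_bigr => x _; exact: h.
Qed.

End RGamTensor.

Section Objects.
Variables (R : realType) (S : padic_setting R) (n : nat).
Variable rho : 'I_n -> {posnum R}.
Local Notation p := (prm S).
Local Notation K := (fK S).
Local Notation KG := (KGamma S).
Local Notation radius := ('I_n -> {posnum R}).
Local Notation Rr := (Rrho S rho).
Local Notation RG := (RGam S rho).

(* With values in the extended reals, so that no convention is needed for
   unbounded sets; the values are finite on KJG a b. *)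
Definition gauss_norm (r : radius) (f : 'rV[int]_n -> KG) : \bar R :=
  ereal_sup [set (absG (f i) * lmonom (rnum r) i)%:E | i in [set: 'rV[int]_n]].

Definition sup_norm (a b : radius) (f : 'rV[int]_n -> KG) : \bar R :=
  ereal_sup [set gauss_norm r f | r in polysegment a b].

Definition mx_norm (a b : radius) (m : nat)
    (E : 'I_m -> 'I_m -> ('rV[int]_n -> KG)) : \bar R :=
  \big[Order.max/0%E]_(i < m) \big[Order.max/0%E]_(j < m) sup_norm a b (E i j).

Definition KJ_rho (a b : radius) : set Rr := [set f | KJ a b (RGcoef f)].

(* A finite free R_rho-module am_mod with a model am_ext of its tensor product
   with K(Gamma) over K; am_act z is only meaningful for z in Gamma^n. *)
Record action_module := ActionModule {
  am_mod : lmodType Rr;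
  am_rank : nat;
  am_free : exists e : 'I_am_rank -> am_mod, is_basis [set: Rr] [set: am_mod] e;
  am_ext : lmodType RG;
  am_tens : am_mod -> KG -> am_ext;
  am_tensP : is_tensor (fun (a : K) (x : am_mod) => Rconst rho a *: x)
                       (fun (a : K) (c : KG) => embG a * c) am_tens;
  am_tensZ : forall (f : Rr) (c d : KG) (x : am_mod),
    (RGconst rho c * Rval f) *: am_tens x d = am_tens (f *: x) (c * d);
  am_act : ('I_n -> KG) -> am_ext -> am_ext }.

Section OneModule.
Variable P : action_module.
Local Notation M := (am_mod P).
Local Notation m := (am_rank P).
Local Notation tens := (@am_tens P).
Local Notation act := (@am_act P).

Definition semilinear_action : Prop :=
  [/\ forall z, inGamma z -> zmod_morphism (act z),
      forall z (f : RG) x, inGamma z -> act z (f *: x) = zstar z f *: act z x,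
      forall x, act (fun=> 1) x = x &
      forall z z' x, inGamma z -> inGamma z' ->
        act (fun j => z j * z' j) x = act z (act z' x)].

Definition galois_compatible : Prop :=
  forall sigma : {rmorphism KG -> KG}, bijective sigma ->
    (forall a : K, sigma (embG a) = embG a) ->
    (* g is the action of sigma through the factor K(Gamma). *)
    exists2 g : {additive am_ext P -> am_ext P},
      forall x c, g (tens x c) = tens x (sigma c) &
      forall z x, inGamma z ->
        g (act z x) = act (fun j => sigma (z j)) (g x).

(* The (injective) image in am_ext P of the tensor product of P' and K(Gamma). *)
Definition sub_ext (P' : set M) : set (am_ext P) :=
  [set y | exists2 s : seq (M * KG), (forall x, x \in s -> P' x.1) &
                                     y = \sum_(x <- s) tens x.1 x.2].

(* P' is finite free over K_{J,n} and spans P freely over R_rho. *)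
Definition extended_from (a b : radius) (P' : set M) : Prop :=
  exists2 e : 'I_m -> M, is_basis (KJ_rho a b) P' e &
                         is_basis [set: Rr] [set: M] e.

Definition bounded_action (a b : radius) (e : 'I_m -> M) : Prop :=
  exists2 l : nat, (0 < l)%N &
    forall (k : nat) (z : 'I_n -> KG), (0 < k)%N -> inGamma_s k z ->
      exists E : 'M[RG]_m,
        [/\ forall i j, KJG a b (RGcoef (E i j)),
            forall j, act z (tens (e j) 1) = \sum_(i < m) E i j *: tens (e i) 1 &
            (mx_norm a b (fun i j => RGcoef (E i j))
               <= (p%:R ^+ (l * k))%:E)%E].

Definition defined_by (a b : radius) (P' : set M) : Prop :=
  [/\ interior a b rho,
      extended_from a b P',
      (* the action is induced from one on P' *)
      forall z y, inGamma z -> sub_ext P' y -> sub_ext P' (act z y) &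
      exists2 e : 'I_m -> M, is_basis (KJ_rho a b) P' e & bounded_action a b e].

End OneModule.

Record objC := ObjC {
  ob_module :> action_module;
  ob_semilinear : semilinear_action ob_module;
  ob_galois : galois_compatible ob_module;
  ob_defined : exists (a b : radius) (P' : set (am_mod ob_module)),
    defined_by a b P' }.

End Objects.

(* The inverse limit of the Z / p^k: zres a k is the residue of a modulo p ^ k,
   and the compatibility forces zres a k < p ^ k. *)
Record padic_int (p : nat) := MkPadicInt {
  zres : nat -> nat;
  zres_compat : forall k, (zres k.+1 %% p ^ k)%N = zres k }.

Section Exponents.
Variables (R : realType) (S : padic_setting R) (n : nat).
Variable rho : 'I_n -> {posnum R}.
Local Notation p := (prm S).
Local Notation KG := (KGamma S).
Local Notation radius := ('I_n -> {posnum R}).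
Local Notation Rr := (Rrho S rho).

(* z ^ a, for z a p^k-th root of unity. *)
Definition zp_pow (k : nat) (z : KG) (a : padic_int p) : KG := z ^+ zres a k.

(* The diagonal matrix A^i is given by its diagonal entries A i. *)
Definition zeta_pow (k m : nat) (z : 'I_n -> KG) (A : 'I_n -> 'I_m -> padic_int p)
  : 'M[KG]_m :=
  \big[mulmx/1%:M]_(i < n) diag_mx (\row_j zp_pow k (z i) (A i j)).

Variable P : objC S rho.
Local Notation M := (am_mod P).
Local Notation m := (am_rank P).

Definition exponent_in_basis (a b : radius) (e : 'I_m -> M)
    (A : 'I_n -> 'I_m -> padic_int p) : Prop :=
  exists Sk : nat -> 'M[Rr]_m,
    let v k j := \sum_(i < m) Sk k i j *: e i in
    [/\ forall k i j, (0 < k)%N -> KJ_rho a b (Sk k i j),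
        forall k z j, (0 < k)%N -> inGamma_s k z ->
          @am_act _ _ _ _ P z (am_tens (v k j) 1)
          = \sum_(i < m) am_tens (v k i) (zeta_pow k z A i j),
        exists2 l : nat, (0 < l)%N & forall k, (0 < k)%N ->
          (mx_norm a b (fun i j => RGcoef (Sk k i j))
             <= (p%:R ^+ (l * k))%:E)%E &
        forall k, (0 < k)%N -> (1%:E <= sup_norm a b (RGcoef (\det (Sk k))))%E].

Definition is_exponent (A : 'I_n -> 'I_m -> padic_int p) : Prop :=
  exists (a b : radius) (P' : set M) (e : 'I_m -> M),
    [/\ defined_by a b P',
        is_basis (KJ_rho a b) P' e &
        exponent_in_basis a b e A].

End Exponents.

(* Main.v *)
Require Import Defs.
From HB Require Import structures.
From mathcomp Require Import all_boot all_order all_algebra perm.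
From mathcomp Require Import cyclic separable cyclotomic.
From mathcomp Require Import boolp classical_sets.
From mathcomp Require Import reals constructive_ereal ereal interval_inference.
Set Implicit Arguments.
Unset Strict Implicit.
Unset Printing Implicit Defensive.
Import Order.TTheory GRing.Theory Num.Theory.
Local Open Scope ring_scope.

(** Fix a basis [e] of the model over a polysegment in which the action is
    bounded.  For [a] in [Z^n] the operator
      [pi_{k,a} = p^{-kn} \sum_(z in Gamma_k^n) z^{-a} act z]
    projects onto the part of the module on which [Gamma_k^n] acts through the
    character [z |-> z^a] ([projector], [act_projector]).  Let the [j]-th column
    of [S_{k,a}] hold the coordinates of [pi_{k,a_j} e_j].  Then condition (1)
    in the definition of an exponent holds by construction, and condition (2)
    follows from the bound on the matrices of the action, as [p^{-kn}] costs a
    factor [p^{kn}] in absolute value ([projector_mx_norm]).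

    What is left to arrange is condition (3), together with the choice of
    [p]-adic integers.  Summing over the lifts of a character of [Gamma_k^n] to
    [Gamma_{k+1}^n] gives [pi_{k,a} = \sum_d pi_{k+1,a+p^k d}], where [d] ranges
    over the digit vectors in [{0,...,p-1}^n] ([projector_refine]).  By
    multilinearity [det S_{k,a}] is therefore the sum of the determinants
    [det S_{k+1,a'}] over all lifts [a'] of [a] ([det_projector_mx]).  As
    [S_0] is the identity and the absolute value is nonarchimedean, digits can be
    chosen one after the other so that the constant coefficient of
    [det S_{k,a}] always has absolute value at least 1 ([digits_exist]); the
    limits of the digit expansions are the diagonal entries of the exponent.

    A priori the entries of [S_{k,a}] have coefficients in [K(Gamma)].  Since the
    action is compatible with [Gal(K(Gamma)/K)] and an automorphism permutes
    [Gamma_k^n], they are Galois invariant ([projector_mx_galois]), and the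
    fixed field of [Gal(K(Gamma)/K)] is [K] ([fixed_field]).  This last fact about
    the infinite extension [K(Gamma)] is obtained by extending a
    nontrivial conjugation step by step along a tower of simple extensions that
    exhausts [K(Gamma)]. *)

(** * Conjugate elements in an algebraic closure *)

Section Conjugates.
Variables (K : fieldType) (L : closedFieldType) (iota : {rmorphism K -> L}).
Local Notation "q ^i" := (map_poly iota q) (at level 2, format "q ^i").
Implicit Types (x y z : L) (q : {poly K}).

(** For algebraic [x], being a root of its minimal polynomial, in a form that
    needs no choice of that polynomial. *)
Definition conjugate x y := forall q, root q^i x -> root q^i y.

(** An annihilating polynomial of least degree divides all the others, by
    Euclidean division. *)
Lemma minpoly_exists x : algebraicOver iota x ->
  exists m : {poly K}, [/\ m \is monic, root m^i x &
    forall q, root q^i x -> m %| q].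
Proof.
move=> [q q0 qx].
have ex : exists d, `[< exists q, [/\ q != 0, root q^i x & size q = d] >].
  by exists (size q); apply/asboolP; exists q.
case: (ex_minnP ex) => d /asboolP[m [m0 mx sm]] hmin.
have c0 : lead_coef m != 0 by rewrite lead_coef_eq0.
exists ((lead_coef m)^-1 *: m); split.
- by rewrite monicE lead_coefZ mulVf.
- by rewrite map_polyZ rootZ // fmorph_eq0 invr_eq0.
move=> r rx; rewrite dvdpZl ?invr_eq0 // /dvdp; apply/eqP.
apply: contraTeq isT => r0.
suff : (d <= size (r %% m)%R)%N by rewrite leqNgt -sm ltn_modp m0.
apply: hmin; apply/asboolP; exists (r %% m); split=> //.
by move: rx; rewrite {1}(divp_eq r m) rmorphD rmorphM !rootE hornerD hornerM
  (rootP mx) mulr0 add0r.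
Qed.

(** If [f] is coprime to the characteristic polynomial, a Bezout relation and the
    Cayley-Hamilton theorem give an inverse of [f(A)]; at a common root [x], an
    eigenvector for [x] is killed by [f(A)]. *)
Lemma horner_mx_nonunit n (A : 'M[L]_n.+1) (f : {poly L}) :
  (horner_mx A f \notin unitmx) <-> exists2 x, root (char_poly A) x & root f x.
Proof.
split=> [nu|[x Ax fx]].
  apply: contrapT => h.
  have : coprimep (char_poly A) f.
    apply/Pdiv.ClosedField.coprimepP => x Ax.
    by rewrite -rootE; apply/negP => fx; apply: h; exists x.
  move/Bezout_eq1_coprimepP => [[u w] /= e].
  move/(congr1 (horner_mx A)): e.
  rewrite rmorphD !rmorphM /= Cayley_Hamilton mulr0 add0r rmorph1 => /mulmx1_unit[_].
  by apply/negP.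
move: Ax; rewrite -eigenvalue_root_char => /eigenvalueP[w wA w0].
have [g ->] := factor_theorem f x fx.
rewrite mulrC rmorphM /= unitmx_mul negb_and; apply/orP; left.
apply: contra w0 => Au; rewrite -(mulmxK Au w).
by rewrite rmorphB /= horner_mx_X horner_mx_C mulmxBr wA mul_mx_scalar subrr mul0mx.
Qed.

Lemma root_char_poly_horner_mx n (A : 'M[L]_n.+1) (f : {poly L}) z :
  root (char_poly (horner_mx A f)) z <->
  exists2 x, root (char_poly A) x & f.[x] = z.
Proof.
rewrite -eigenvalue_root_char /eigenvalue /eigenspace kermx_eq0 row_free_unit.
have -> : horner_mx A f - z%:M = horner_mx A (f - z%:P).
  by rewrite rmorphB /= horner_mx_C.
rewrite horner_mx_nonunit; split=> -[x Ax]; last first.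
  by move=> <-; exists x => //; rewrite rootE !hornerE subrr.
by rewrite rootE !hornerE subr_eq0 => /eqP e; exists x.
Qed.

(** With [C] the companion matrix of the minimal polynomial of [x], the roots of
    the characteristic polynomial of [q(C)], which has coefficients in [K], are
    exactly the values of [q] at the conjugates of [x]. *)
Lemma conjugate_lift x q y : algebraicOver iota x -> conjugate q^i.[x] y ->
  exists2 x', conjugate x x' & q^i.[x'] = y.
Proof.
move=> /minpoly_exists[m [mm mx mmin]] hc.
have [n [C hC]] : exists n (C : 'M[K]_n.+1), char_poly C = m.
  have := companionmxK mm.
  move: (companionmx m); case: (size m).-1 => [|n] C hC; last by exists n, C.
  by move: mx; rewrite -hC /char_poly det_mx00 rmorph1 rootC oner_eq0.
have hm z : root (char_poly (map_mx iota C)) z = root m^i z.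
  by rewrite -hC map_char_poly.
have hq z : root (char_poly (horner_mx C q))^i z <->
    exists2 x, root m^i x & q^i.[x] = z.
  rewrite map_char_poly map_horner_mx root_char_poly_horner_mx.
  by split=> -[w wm e]; exists w => //; move: wm; rewrite hm.
have /hc/hq[x' mx' e] : root (char_poly (horner_mx C q))^i q^i.[x].
  by apply/hq; exists x.
exists x' => // r /mmin/dvdpP[s ->].
by rewrite rmorphM rootM mx' orbT.
Qed.

(** Otherwise the minimal polynomial is [(X - x)^d], and since [d] is invertible
    its subleading coefficient [- d x] would put [x] in [K]. *)
Lemma conjugate_other x : [pchar K] =i pred0 -> algebraicOver iota x ->
  (forall a, x <> iota a) -> exists2 y, conjugate x y & y != x.
Proof.
move=> ch0 /minpoly_exists[m [mm mx mmin]] xK.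
have hc z : root m^i z -> conjugate x z.
  move=> mz r /mmin/dvdpP[s ->].
  by rewrite rmorphM rootM mz orbT.
apply: contrapT => h.
have {h hc} h z : root m^i z -> z = x.
  by move=> /hc cz; apply/eqP; apply: contrapT => /negP zx; apply: h; exists z.
have [r er] := closed_field_poly_normal m^i.
have rE : r = nseq (size r) x.
  apply/all_pred1P/allP => z zr; apply/eqP/h.
  rewrite er rootZ ?lead_coef_eq0 ?map_poly_eq0 ?monic_neq0 //.
  by rewrite root_prod_XsubC.
have {}er : m^i = ('X - x%:P) ^+ size r.
  rewrite er lead_coef_map (monicP mm) rmorph1 scale1r [in LHS]rE.
  by rewrite big_nseq -Monoid.iteropE.
have r0 : (size r != 0)%N.
  apply/eqP => r0; move: mx; rewrite er r0 expr0 rootC oner_eq0 //.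
have d0 : (size r)%:R != 0 :> K.
  by move/pcharf0P: ch0 => ->.
have e : iota m`_(size r).-1 = - (x *+ size r).
  rewrite -coef_map.
  have -> : m^i = \prod_(z <- nseq (size r) x) ('X - z%:P).
    by rewrite er big_nseq -Monoid.iteropE.
  have := @coefPn_prod_XsubC _ (nseq (size r) x).
  rewrite size_nseq => -> //; congr (- _).
  by rewrite big_nseq -Monoid.iteropE.
(* m`_(d - 1) = - d x *)
apply: (xK (- m`_(size r).-1 / (size r)%:R)).
rewrite fmorph_div rmorphN e opprK rmorph_nat -[x *+ _]mulr_natr mulfK //.
by rewrite -(rmorph_nat iota) fmorph_eq0.
Qed.

Section Tower.
(* The fields K(x s) increase with s, and x' is a compatible choice of conjugates
   of their generators, that is, a K-embedding of their union. *)
Variables (x x' : nat -> L) (e : nat -> {poly K}).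
Hypothesis xe : forall s, x s = (e s)^i.[x s.+1].
Hypothesis xe' : forall s, x' s = (e s)^i.[x' s.+1].
Hypothesis cx : forall s, conjugate (x s) (x' s).

Lemma tower_raise s t q : (s <= t)%N ->
  exists2 r, q^i.[x s] = r^i.[x t] & q^i.[x' s] = r^i.[x' t].
Proof.
elim: t => [|t IH]; first by rewrite leqn0 => /eqP ->; exists q.
rewrite leq_eqVlt => /predU1P[->|/IH[r -> ->]]; first by exists q.
by exists (r \Po e t); rewrite map_comp_poly horner_comp -?xe -?xe'.
Qed.

Lemma tower_eq s t q r : q^i.[x s] = r^i.[x t] -> q^i.[x' s] = r^i.[x' t].
Proof.
move=> h.
have [q1 h1 h1'] := tower_raise q (leq_maxl s t).
have [r1 h2 h2'] := tower_raise r (leq_maxr s t).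
rewrite h1' h2'; apply/eqP; rewrite -subr_eq0 -hornerN -hornerD -rmorphB.
apply: cx; rewrite rootE rmorphB hornerD hornerN -h1 -h2 h subrr //.
Qed.
End Tower.

(** Solve the minimal polynomial relation [d(y) y + c = 0] for [y^-1]. *)
Lemma algebraic_inv_horner y : algebraicOver iota y ->
  exists q, y^-1 = q^i.[y].
Proof.
move=> /minpoly_exists[m [mm my mmin]].
have [->|y0] := eqVneq y 0; first by exists 0; rewrite rmorph0 horner0 invr0.
have [d [c ed]] : exists d c, m = d * 'X + c%:P.
  elim/poly_ind: (m) => [|d c _]; last by exists d, c.
  by exists 0, 0; rewrite mul0r add0r.
have my0 : d^i.[y] * y + iota c = 0.
  by have /rootP := my; rewrite ed rmorphD rmorphM /= map_polyX map_polyC !hornerE.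
have c0 : c != 0.
  apply: contraTneq isT => c0.
  have md : m %| d.
    apply: mmin; rewrite rootE -(mulIr_eq0 _ (mulIf y0)).
    by move: my0; rewrite c0 rmorph0 addr0 => ->.
  have m0 := monic_neq0 mm.
  have d0 : d != 0 by apply: contraNneq m0 => d0; rewrite ed d0 c0 mul0r addr0.
  by have := dvdp_leq d0 md; rewrite ed c0 addr0 size_mulX // ltnn.
exists (- c^-1 *: d).
rewrite map_polyZ hornerZ rmorphN fmorphV mulNr -mulrN.
have -> : - d^i.[y] = iota c / y.
  by apply: (mulIf y0); rewrite divfK // mulNr; apply/eqP; rewrite eqr_oppLR -addr_eq0 my0.
by rewrite mulKf // fmorph_eq0.
Qed.
End Conjugates.

(** * The Galois group of K(Gamma) over K *)

Section FixedField.
Variables (R : realType) (S : padic_setting R).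
Local Notation p := (prm S).
Local Notation K := (fK S).
Local Notation Kb := (fKbar S).
Local Notation KG := (KGamma S).
Local Notation "q ^i" := (map_poly (emb S) q) (at level 2, format "q ^i").

Lemma prm_exp_gt0 s : (0 < p ^ s)%N.
Proof. by rewrite expn_gt0 prime_gt0 // prm_prime. Qed.

Lemma primitive_root_exists s : exists w : Kb, (p ^ s).-primitive_root w.
Proof.
have [r er] := closed_field_poly_normal ('X^(p ^ s) - 1 : {poly Kb}).
rewrite lead_coefXnsubC ?prm_exp_gt0 // scale1r in er.
have sr : size r = (p ^ s)%N.
  by apply/eqP; rewrite -eqSS -(size_prod_XsubC _ id) -er size_XnsubC ?prm_exp_gt0.
have ur : uniq r.
  rewrite -separable_prod_XsubC -er separable_Xn_sub_1 //.
  have -> : (p ^ s)%:R = emb S (p ^ s)%:R by rewrite rmorph_nat.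
  have /pcharf0P h := fK_char0 S.
  by rewrite fmorph_eq0 h -lt0n prm_exp_gt0.
have /hasP[w _ hw] : has (p ^ s).-primitive_root r.
  apply: has_prim_root; rewrite ?sr ?prm_exp_gt0 //.
  by apply/allP => z zr; rewrite /root_of_unity er root_prod_XsubC.
by exists w.
Qed.

Lemma root_in_KGamma s (z : Kb) : (p ^ s).-unity_root z -> z \in @in_KGamma R S.
Proof. by move=> hz; apply/asboolP => E _ _ h; apply: h hz. Qed.

Lemma horner_in_KGamma q (z : Kb) :
  z \in @in_KGamma R S -> q^i.[z] \in @in_KGamma R S.
Proof.
move=> hz; apply: rpred_horner => //; apply/polyOverP => i.
by rewrite coef_map emb_in_KGamma.
Qed.

Lemma KGval_unity_root s (z : KG) :
  (p ^ s).-unity_root (KGval z) = (p ^ s).-unity_root z.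
Proof.
by rewrite !unity_rootE -(inj_eq val_inj) /= -[KGval z]/(val z) -rmorphXn.
Qed.

(** All [p^s]-th roots of unity of the algebraic closure lie in [K(Gamma)], so
    the powers of a primitive one exhaust those of [K(Gamma)]. *)
Lemma roots_of_unity_seq s : exists r : seq KG,
  uniq r /\ forall z, (z \in r) = (p ^ s).-unity_root z.
Proof.
have [w hw] := primitive_root_exists s.
have wu : (p ^ s).-unity_root w by rewrite unity_rootE (prim_expr_order hw).
pose wG := MkKGamma (root_in_KGamma wu).
have wGX i : KGval (wG ^+ i) = w ^+ i.
  by rewrite -[KGval _]/(val _) rmorphXn.
exists (undup [seq wG ^+ i | i <- iota 0 (p ^ s)]); split; first exact: undup_uniq.
move=> z; rewrite mem_undup -KGval_unity_root; apply/mapP/idP.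
  move=> [i _ ->]; rewrite wGX unity_rootE exprAC (prim_expr_order hw) expr1n //.
rewrite unity_rootE => /eqP/(prim_rootP hw)[i hi].
exists (i : nat); first by rewrite mem_iota /=.
by apply: val_inj; rewrite /= wGX.
Qed.

Section TowerMap.
Variables (x x' : nat -> Kb) (e : nat -> {poly K}).
Hypothesis xe : forall s, x s = (e s)^i.[x s.+1].
Hypothesis xe' : forall s, x' s = (e s)^i.[x' s.+1].
Hypothesis cx : forall s, conjugate (emb S) (x s) (x' s).
Hypothesis xG : forall s z, (p ^ s).-unity_root z -> exists t q, z = q^i.[x t].
Hypothesis x'G : forall s, x' s \in @in_KGamma R S.

Let level2 q r s t : exists q1 r1 u,
  [/\ q^i.[x s] = q1^i.[x u], q^i.[x' s] = q1^i.[x' u],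
      r^i.[x t] = r1^i.[x u] & r^i.[x' t] = r1^i.[x' u]].
Proof.
have [q1 h1 h1'] := tower_raise xe xe' q (leq_maxl s t).
have [r1 h2 h2'] := tower_raise xe xe' r (leq_maxr s t).
by exists q1, r1, (maxn s t).
Qed.

(** The union of the fields [K(x s)] is a field, since inverses of algebraic
    elements are polynomials in them; it contains [K] and all the roots of unity
    that generate [K(Gamma)]. *)
Lemma tower_generates (y : Kb) : y \in @in_KGamma R S -> exists t q, y = q^i.[x t].
Proof.
move=> /asboolP/(_ (fun y => `[< exists t q, y = q^i.[x t] >])) h.
apply/asboolP; apply: h => [||s z /xG h]; last exact/asboolP.
  split.
  - by apply/asboolP; exists 0%N, 1; rewrite rmorph1 hornerC.
  - move=> _ _ /asboolP[t [q ->]] /asboolP[u [r ->]]; apply/asboolP.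
    have [q1 [r1 [w [-> _ -> _]]]] := level2 q r t u.
    by exists w, (q1 - r1); rewrite rmorphB hornerD hornerN.
  move=> _ _ /asboolP[t [q ->]] /asboolP[u [r ->]]; apply/asboolP.
  have [r' ->] := algebraic_inv_horner (emb_algebraic r^i.[x u]).
  rewrite -horner_comp -map_comp_poly.
  have [q1 [r1 [w [-> _ -> _]]]] := level2 q (r' \Po r) t u.
  by exists w, (q1 * r1); rewrite rmorphM hornerM.
by move=> a; apply/asboolP; exists 0%N, a%:P; rewrite map_polyC hornerC.
Qed.

(** The rule [q(x s) |-> q(x' s)] is well defined by conjugacy, and an
    endomorphism because any two elements can be written at a common level.  It
    is onto because it permutes the finite group of [p^s]-th roots of unity for
    each [s], so that its image contains the generators of [K(Gamma)]. *)
Lemma tower_automorphism : exists sigma : {rmorphism KG -> KG},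
  [/\ bijective sigma, forall a, sigma (embG a) = embG a &
      forall (y : KG) s q, KGval y = q^i.[x s] -> KGval (sigma y) = q^i.[x' s]].
Proof.
have /choice[f hf] : forall y : KG, exists z : KG, exists t q,
    KGval y = q^i.[x t] /\ KGval z = q^i.[x' t].
  move=> y; have [t [q eq]] := tower_generates (KGvalP y).
  by exists (MkKGamma (horner_in_KGamma q (x'G t))), t, q.
have fE y s q : KGval y = q^i.[x s] -> KGval (f y) = q^i.[x' s].
  have [t [r [h ->]]] := hf y; rewrite h; exact: (tower_eq xe xe' cx).
have fB : zmod_morphism f.
  move=> y z; apply: val_inj => /=.
  have [t [q [hy ->]]] := hf y; have [u [r [hz ->]]] := hf z.
  have [q1 [r1 [w [e1 -> e2 ->]]]] := level2 q r t u.
  rewrite (fE _ w (q1 - r1)) ?rmorphB ?hornerD ?hornerN //=.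
  by rewrite hy hz e1 e2.
have fM : monoid_morphism f.
  split.
    by apply: val_inj; rewrite /= (fE _ 0%N 1) // rmorph1 hornerC.
  move=> y z; apply: val_inj => /=.
  have [t [q [hy ->]]] := hf y; have [u [r [hz ->]]] := hf z.
  have [q1 [r1 [w [e1 -> e2 ->]]]] := level2 q r t u.
  rewrite (fE _ w (q1 * r1)) ?rmorphM ?hornerM //=.
  by rewrite hy hz e1 e2.
pose sigma : {rmorphism KG -> KG} := HB.pack f
  (GRing.isZmodMorphism.Build _ _ _ fB) (GRing.isMonoidMorphism.Build _ _ _ fM).
exists sigma; split=> //.
- have surj y : exists z, sigma z = y.
    suff : exists z, KGval (sigma z) = KGval y by move=> [z /val_inj]; exists z.
    have /asboolP/(_ (fun y => `[< exists z, KGval (sigma z) = y >])) h := KGvalP y.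
    apply/asboolP; apply: h => [|a|s z hz].
    + split.
      * by apply/asboolP; exists 1; rewrite rmorph1.
      * move=> _ _ /asboolP[y1 <-] /asboolP[y2 <-]; apply/asboolP.
        by exists (y1 - y2); rewrite rmorphB.
      * move=> _ _ /asboolP[y1 <-] /asboolP[y2 <-]; apply/asboolP.
        by exists (y1 / y2); rewrite fmorph_div.
    + apply/asboolP; exists (embG a).
      by rewrite /= (fE _ 0%N a%:P) map_polyC hornerC.
    + apply/asboolP; have [r [ur hr]] := roots_of_unity_seq s.
      have sub : {subset [seq sigma y | y <- r] <= r}.
        move=> _ /mapP[u ur' ->]; move: ur'; rewrite !hr !unity_rootE.
        by rewrite -rmorphXn => /eqP ->; rewrite rmorph1.
      have um : uniq [seq sigma y | y <- r] by rewrite map_inj_uniq //; apply: fmorph_inj.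
      have [_ e'] := uniq_min_size um sub (eq_leq (esym (size_map _ _))).
      have : MkKGamma (root_in_KGamma hz) \in r by rewrite hr -KGval_unity_root.
      by rewrite -e' => /mapP[u _ e2]; exists u; rewrite -e2.
  have [g hg] := choice surj.
  by exists g => // y; apply: (fmorph_inj sigma); rewrite hg.
- by move=> a; apply: val_inj; rewrite /= (fE _ 0%N a%:P) map_polyC hornerC.
Qed.

End TowerMap.

Lemma conjugate_unity_root s (z z' : Kb) :
  conjugate (emb S) z z' -> (p ^ s).-unity_root z -> (p ^ s).-unity_root z'.
Proof.
move=> h; have := h ('X^(p ^ s) - 1).
by rewrite rmorphB rmorph1 /= map_polyXn.
Qed.

(** If [x] is not in [K] it has a conjugate [y <> x].  Write [x = q(w s0)] with
    [w s] a primitive [p^s]-th root of unity; [conjugate_lift] provides first a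
    conjugate of [w s0] at which [q] takes the value [y], and then compatible
    conjugates of all the later [w s].  The resulting automorphism moves [x]. *)
Lemma fixed_field (x : KG) :
  (forall sigma : {rmorphism KG -> KG}, bijective sigma ->
     (forall a, sigma (embG a) = embG a) -> sigma x = x) ->
  exists a, x = embG a.
Proof.
move=> fx; apply: contrapT => xK.
have [w hw] := choice primitive_root_exists.
have wG s z : (p ^ s).-unity_root z -> exists q, z = q^i.[w s].
  rewrite unity_rootE => /eqP/(prim_rootP (hw s))[i ->].
  by exists 'X^i; rewrite map_polyXn hornerXn.
have wu s : (p ^ s).-unity_root (w s).
  by rewrite unity_rootE (prim_expr_order (hw s)).
have wS s : exists e, w s = e^i.[w s.+1].
  apply: wG; rewrite unity_rootE expnSr exprM.
  by have := wu s; rewrite unity_rootE => /eqP ->; rewrite expr1n.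
have [e we] := choice wS.
have [s0 [q xq]] : exists t q, KGval x = q^i.[w t].
  apply: (tower_generates we we) (KGvalP x) => // s z /wG[q ->].
  by exists s, q.
have [y cy yx] : exists2 y, conjugate (emb S) (KGval x) y & y != KGval x.
  apply: conjugate_other (fK_char0 S) (emb_algebraic _) _ => a ea.
  by apply: xK; exists a; apply: val_inj.
have [w0 cw0 qw0] : exists2 x', conjugate (emb S) (w s0) x' & q^i.[x'] = y.
  by apply: conjugate_lift (emb_algebraic _) _; rewrite -xq.
have step t (u : {u | conjugate (emb S) (w (s0 + t)%N) u}) :
    {u' | conjugate (emb S) (w (s0 + t.+1)%N) u' & (e (s0 + t)%N)^i.[u'] = sval u}.
  case: u => u cu; apply: cid2 => /=.
  by apply: conjugate_lift (emb_algebraic _) _; rewrite addnS -we.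
pose W := fix W t : {u | conjugate (emb S) (w (s0 + t)%N) u} :=
  if t is t'.+1 then exist _ (s2val (step t' (W t'))) (s2valP (step t' (W t')))
  else exist _ w0 (eq_ind_r (fun s => conjugate (emb S) (w s) w0) cw0 (addn0 s0)).
have [||||sigma [bs sK sE]] := @tower_automorphism (fun t => w (s0 + t)%N)
    (fun t => sval (W t)) (fun t => e (s0 + t)%N) _ _ (fun t => svalP (W t)).
- by move=> t; rewrite addnS.
- by move=> t; rewrite /= (s2valP' (step t (W t))).
- move=> s z hz; have [r er] := wG s z hz.
  have [r' er' _] := tower_raise we we r (leq_addl s0 s).
  by exists s, r'; rewrite -er'.
- by move=> t; apply: root_in_KGamma (conjugate_unity_root (svalP (W t)) (wu _)).
have /= : KGval (sigma x) = q^i.[sval (W 0%N)] by apply: sE; rewrite addn0.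
by rewrite fx // qw0 => h; rewrite h eqxx in yx.
Qed.

End FixedField.

(** * Gauss norms and Laurent series *)

Section Series.
Variables (R : realType) (S : padic_setting R) (n : nat).
Local Notation p := (prm S).
Local Notation KG := (KGamma S).
Local Notation I := 'rV[int]_n.
Local Notation aG := (@absG R S).
Implicit Types (a b r : 'I_n -> {posnum R}) (f : I -> KG).

Lemma absG_unity_root q (z : KG) : (0 < q)%N -> q.-unity_root z -> aG z = 1.
Proof.
move=> q0; rewrite unity_rootE => /eqP zq.
have hv := absG_nonarch S.
have vX k : aG (z ^+ k) = aG z ^+ k.
  by elim: k => [|k IH]; rewrite ?expr0 ?(nabs1 hv) // !exprS (nabsM hv) IH.
apply/eqP; rewrite -(pexpr_eq1 q0) ?(nabs_ge0 hv) //.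
by rewrite -vX zq (nabs1 hv).
Qed.

Lemma sup_norm_le a b f (C : R) :
  (sup_norm a b f <= C%:E)%E <->
  forall r i, polysegment a b r -> aG (f i) * lmonom (rnum r) i <= C.
Proof.
split=> [h r i hr|h].
  rewrite -lee_fin; apply: le_trans h.
  apply: le_trans (ereal_sup_ubound _); last by exists r; first exact: hr.
  by apply: ereal_sup_ubound; exists i.
apply: ge_ereal_sup => _ [r hr <-]; apply: ge_ereal_sup => _ [i _ <-].
by rewrite lee_fin h.
Qed.

Lemma sup_norm_ge a b f r i : polysegment a b r ->
  ((aG (f i) * lmonom (rnum r) i)%:E <= sup_norm a b f)%E.
Proof.
move=> hr; apply: le_trans (ereal_sup_ubound _); last by exists r; first exact: hr.
by apply: ereal_sup_ubound; exists i.
Qed.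

Lemma mx_norm_le a b m (E : 'I_m -> 'I_m -> I -> KG) (C : R) : 0 <= C ->
  (mx_norm a b E <= C%:E)%E <-> forall i j, (sup_norm a b (E i j) <= C%:E)%E.
Proof.
move=> C0; split=> [h i j|h].
  by apply: le_trans h; rewrite /mx_norm (bigD1 i) //= le_max; apply/orP; left;
    rewrite (bigD1 j) //= le_max lexx.
rewrite /mx_norm; elim/big_ind: _ => [|x y hx hy|i _]; first by rewrite lee_fin.
  by rewrite ge_max hx.
elim/big_ind: _ => [|x y hx hy|j _]; first by rewrite lee_fin.
  by rewrite ge_max hx.
exact: h.
Qed.

Lemma KJG_sum a b (T : eqType) (s : seq T) (c : T -> KG) (F : T -> I -> KG) :
  (forall t, t \in s -> KJG a b (F t)) ->
  KJG a b (fun i => \sum_(t <- s) c t * F t i).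
Proof.
elim: s => [|t s IH] h.
  by exists [::] => //; apply/funext => i; rewrite /span_series !big_nil.
have [|u hu eu] := IH; first by move=> w ws; apply: h; rewrite inE ws orbT.
have [w hw ew] := h t (mem_head _ _).
exists ([seq (c t * x.1, x.2) | x <- w] ++ u).
  by move=> x; rewrite mem_cat => /orP[/mapP[y /hw hy ->]|/hu].
apply/funext => i; rewrite big_cons -[X in _ + X]/((fun i => _) i).
rewrite [X in _ + X](congr1 (fun f => f i) eu) ew /span_series big_cat big_map /=.
by congr (_ + _); rewrite mulr_sumr; apply: eq_bigr => x _; rewrite mulrA.
Qed.

Lemma KJG_decays a b f r : KJG a b f -> polysegment a b r -> decays aG r f.
Proof.
move=> [s hs ->] hr; have hv := absG_nonarch S.
elim: s hs => [|x s IH] hs e e0.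
  by exists 0%N => i _; rewrite /span_series big_nil (nabs0 hv) mul0r.
have [|N hN] := IH _ e e0; first by move=> y ys; apply: hs; rewrite inE ys orbT.
have c0 : 0 < aG x.1 + 1 by rewrite ltr_wpDl ?(nabs_ge0 hv).
have [M hM] := hs x (mem_head _ _) r hr _ (divr_gt0 e0 c0).
exists (maxn N M) => i; rewrite geq_max => /andP[iN iM].
rewrite -ltr_pdivlMr ?lmonom_gt0 // /span_series big_cons; apply: (nabsD_lt hv).
  rewrite ltr_pdivlMr ?lmonom_gt0 // (nabsM hv) absG_embG -mulrA.
  have := hM i iM; rewrite ltr_pdivlMr // mulrC => h'; apply: le_lt_trans h'.
  rewrite ler_wpM2r ?lerDl // mulr_ge0 ?(nabs_ge0 (absK_nonarch S)) //.
  exact: ltW (lmonom_gt0 r i).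
by rewrite ltr_pdivlMr ?lmonom_gt0 // hN.
Qed.

(** The coefficients are in [K] by Galois theory, and the decay of the
    coefficients can be read off in [K] as well as in [K(Gamma)]. *)
Lemma KJG_fixed a b f : KJG a b f ->
  (forall sigma : {rmorphism KG -> KG}, bijective sigma ->
     (forall x : fK S, sigma (embG x) = embG x) -> forall i, sigma (f i) = f i) ->
  KJ a b f.
Proof.
move=> hf hs.
have /choice[g hg] : forall i, exists x : fK S, f i = embG x.
  by move=> i; apply: fixed_field => sigma bs sK; apply: hs.
exists g; last exact/funext.
move=> r hr e e0; have [N hN] := KJG_decays hf hr e0.
by exists N => i /hN; rewrite hg absG_embG.
Qed.

End Series.

(** * Sums over the finite groups of roots of unity *)

Section GammaSeq.
Variables (R : realType) (S : padic_setting R) (n : nat).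
Local Notation p := (prm S).
Local Notation KG := (KGamma S).

(** Listing [Gamma_k^n] as a duplicate-free sequence turns the changes of
    variables in sums over it into permutations of sequences. *)
Lemma Gamma_seq_exists k : exists s : seq {ffun 'I_n -> KG},
  uniq s /\ forall z : {ffun 'I_n -> KG}, z \in s <-> inGamma_s k z.
Proof.
have [r [ur hr]] := roots_of_unity_seq S k.
pose dec (x : {ffun 'I_n -> seq_sub r}) : {ffun 'I_n -> KG} := [ffun i => val (x i)].
exists [seq dec x | x <- enum {ffun 'I_n -> seq_sub r}]; split.
  rewrite map_inj_uniq ?enum_uniq // => x y /ffunP e; apply/ffunP => i.
  by apply: val_inj; have := e i; rewrite !ffunE.
move=> z; split=> [/mapP[x _ ->] i|hz].
  by rewrite ffunE -hr; apply: valP.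
apply/mapP; exists [ffun i => SeqSub (etrans (hr (z i)) (hz i))]; first by rewrite mem_enum.
by apply/ffunP => i; rewrite !ffunE.
Qed.

Definition Gamma_seq k := sval (cid (Gamma_seq_exists k)).

Lemma Gamma_seq_uniq k : uniq (Gamma_seq k).
Proof. by have [] := svalP (cid (Gamma_seq_exists k)). Qed.

Lemma Gamma_seqP k (z : {ffun 'I_n -> KG}) : z \in Gamma_seq k <-> inGamma_s k z.
Proof. by have [_] := svalP (cid (Gamma_seq_exists k)). Qed.

Lemma Gamma_seq_reindex k (V : nmodType) (h : {ffun 'I_n -> KG} -> {ffun 'I_n -> KG})
    (F : {ffun 'I_n -> KG} -> V) :
  injective h -> (forall z : {ffun 'I_n -> KG}, inGamma_s k z -> inGamma_s k (h z)) ->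
  \sum_(z <- Gamma_seq k) F (h z) = \sum_(z <- Gamma_seq k) F z.
Proof.
move=> hi hk; rewrite -(big_map h xpredT F); apply: perm_big.
have um : uniq [seq h z | z <- Gamma_seq k] by rewrite map_inj_uniq ?Gamma_seq_uniq.
apply: uniq_perm => //; first exact: Gamma_seq_uniq.
have sub : {subset [seq h z | z <- Gamma_seq k] <= Gamma_seq k}.
  by move=> _ /mapP[z /Gamma_seqP/hk/Gamma_seqP ? ->].
by have [_ ?] := uniq_min_size um sub (eq_leq (esym (size_map _ _))).
Qed.

Lemma Gamma_seq_sub k (V : nmodType) (F : {ffun 'I_n -> KG} -> V) :
  \sum_(z <- Gamma_seq k.+1) (if z \in Gamma_seq k then F z else 0)
    = \sum_(z <- Gamma_seq k) F z.
Proof.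
rewrite -big_mkcond -big_filter; apply: perm_big.
apply: uniq_perm; rewrite ?filter_uniq ?Gamma_seq_uniq // => z.
rewrite mem_filter; apply: andb_idr => /Gamma_seqP hz; apply/Gamma_seqP => j.
have := hz j; rewrite !unity_rootE expnSr exprM => /eqP ->.
by rewrite expr1n.
Qed.

Definition gchar (z : 'I_n -> KG) (a : 'I_n -> nat) : KG := \prod_i z i ^+ a i.

Lemma gcharM (z z' : 'I_n -> KG) a : gchar (fun j => z j * z' j) a = gchar z a * gchar z' a.
Proof. by rewrite /gchar -big_split; apply: eq_bigr => i _; rewrite exprMn. Qed.

Lemma gcharD (z : 'I_n -> KG) a b : gchar z (fun i => a i + b i)%N = gchar z a * gchar z b.
Proof. by rewrite /gchar -big_split; apply: eq_bigr => i _; rewrite exprD. Qed.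

Lemma gchar_unity_root k (z : 'I_n -> KG) a : inGamma_s k z -> (p ^ k).-unity_root (gchar z a).
Proof.
move=> hz; rewrite unity_rootE /gchar -prodrXl; apply/eqP/big1 => i _.
by rewrite exprAC; have := hz i; rewrite unity_rootE => /eqP ->; rewrite expr1n.
Qed.

Lemma unity_root_neq0 q (z : KG) : (0 < q)%N -> q.-unity_root z -> z != 0.
Proof.
move=> q0; rewrite unity_rootE; apply: contraTneq => ->.
by rewrite expr0n eqn0Ngt q0 eq_sym oner_eq0.
Qed.

(** Orthogonality of characters: the characters of [Gamma_{k+1}^n] that are
    trivial on [Gamma_k^n] are the powers [z |-> z^(p^k d)], and the sum is a
    product over the coordinates of geometric sums of [p]-th roots of unity. *)
Lemma gchar_sum k (z : {ffun 'I_n -> KG}) : inGamma_s k.+1 z ->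
  \sum_(d : {ffun 'I_n -> 'I_p}) (gchar z (fun i => p ^ k * d i)%N)^-1
    = if z \in Gamma_seq k then (p ^ n)%:R else 0.
Proof.
move=> hz.
have p0 : (0 < p)%N by rewrite prime_gt0 ?prm_prime.
pose w i := (z i ^+ (p ^ k))^-1.
have wp i : w i ^+ p = 1.
  rewrite /w exprVn -exprM -expnSr.
  by have := hz i; rewrite unity_rootE => /eqP ->; rewrite invr1.
have -> : \sum_(d : {ffun 'I_n -> 'I_p}) (gchar z (fun i => p ^ k * d i)%N)^-1
    = \prod_i \sum_(d < p) w i ^+ d.
  rewrite bigA_distr_bigA; apply: eq_bigr => d _; rewrite /gchar -prodfV.
  by apply: eq_bigr => i _; rewrite exprM exprVn.
case: ifPn => [/Gamma_seqP zk|zk].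
  rewrite (eq_bigr (fun=> p%:R)) => [|i _].
    by rewrite prodr_const card_ord natrX.
  have -> : w i = 1.
    by rewrite /w; have := zk i; rewrite unity_rootE => /eqP ->; rewrite invr1.
  by rewrite (eq_bigr (fun=> 1)) => [|d _]; rewrite ?expr1n // sumr_const card_ord.
have [i wi] : exists i, w i != 1.
  apply: contrapT => h; move/negP: zk; apply; apply/Gamma_seqP => i.
  rewrite unity_rootE -invr_eq1; apply: contrapT => /negP wi; apply: h.
  by exists i.
rewrite (bigD1 i) //= [X in X * _](_ : _ = 0) ?mul0r //.
have /eqP := subrX1 (w i) p.
by rewrite wp subrr eq_sym mulf_eq0 subr_eq0 (negPf wi) => /eqP.
Qed.

End GammaSeq.

(** * Coordinates on the extension of scalars *)

Section Coordinates.
Variables (R : realType) (S : padic_setting R) (n : nat).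
Variable rho : 'I_n -> {posnum R}.
Local Notation p := (prm S).
Local Notation KG := (KGamma S).
Local Notation Rr := (Rrho S rho).
Local Notation RG := (RGam S rho).
Local Notation cst := (@RGconst R S n rho).

Lemma RGcoef_sum (T : Type) (s : seq T) (P : pred T) (F : T -> RG) i :
  RGcoef (\sum_(t <- s | P t) F t) i = \sum_(t <- s | P t) RGcoef (F t) i.
Proof. by elim/big_rec2: _ => // t _ y _ <-. Qed.

Lemma RGconst_zmod_morphism : zmod_morphism cst.
Proof.
move=> c d; apply: RGam_ext => i.
rewrite -[RHS]/(cst c i - cst d i) /= /unit_series.
by case: eqP; rewrite ?subr0.
Qed.

Lemma RGconst_monoid_morphism : monoid_morphism cst.
Proof.
split=> // c d; apply: RGam_ext => i.
by rewrite RGconstE /= /unit_series; case: eqP; rewrite ?mulr0.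
Qed.

HB.instance Definition _ :=
  GRing.isZmodMorphism.Build KG RG cst RGconst_zmod_morphism.
HB.instance Definition _ :=
  GRing.isMonoidMorphism.Build KG RG cst RGconst_monoid_morphism.

Variable P : action_module S rho.
Local Notation M := (am_mod P).
Local Notation m := (am_rank P).
Local Notation tens := (@am_tens _ _ _ _ P).
Local Notation act := (@am_act _ _ _ _ P).

Lemma tensBl c : zmod_morphism (tens^~ c).
Proof. by have [[h _ _] _] := am_tensP P; exact: h. Qed.

Lemma tensBr x : zmod_morphism (tens x).
Proof. by have [[_ h _] _] := am_tensP P; exact: h. Qed.

HB.instance Definition _ x :=
  GRing.isZmodMorphism.Build KG (am_ext P) (tens x) (tensBr x).

Lemma tens_suml (T : Type) (s : seq T) (F : T -> M) c :
  tens (\sum_(t <- s) F t) c = \sum_(t <- s) tens (F t) c.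
Proof.
pose h : {additive M -> am_ext P} := HB.pack (tens^~ c)
  (GRing.isZmodMorphism.Build _ _ _ (tensBl c)).
exact: (raddf_sum h).
Qed.

Lemma scale_tens f c d x : (cst c * Rval f) *: tens x d = tens (f *: x) (c * d).
Proof. exact: am_tensZ. Qed.

Lemma cst_tens c x d : cst c *: tens x d = tens x (c * d).
Proof. by rewrite -{2}[x]scale1r -scale_tens -[Rval 1]/(val 1) rmorph1 mulr1. Qed.

Lemma val_tens f x d : Rval f *: tens x d = tens (f *: x) d.
Proof. by rewrite -[d in RHS]mul1r -scale_tens rmorph1 mul1r. Qed.

Lemma comb_tens (s : seq (KG * Rr)) x d :
  comb s *: tens x d = \sum_(y <- s) tens (y.2 *: x) (y.1 * d).
Proof. by rewrite /comb scaler_suml; apply: eq_bigr => y _; rewrite scale_tens. Qed.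

Variable e : 'I_m -> M.
Hypothesis be : is_basis [set: Rr] [set: M] e.

Lemma coordinates_exist : exists c : M -> 'rV[Rr]_m,
  [/\ forall x, x = \sum_(i < m) c x ord0 i *: e i &
      forall x (d : 'rV[Rr]_m), x = \sum_(i < m) d ord0 i *: e i -> c x = d].
Proof.
have [_ h] := be.
have /choice[c hc] : forall x, exists c : 'rV[Rr]_m,
    x = \sum_(i < m) c ord0 i *: e i.
  by move=> x; have [c [[_ hc] _]] := h x I; exists c.
exists c; split=> // x d hd; have [c' [_ u]] := h x I.
by apply: etrans (esym (u (c x) _)) (u d _).
Qed.

Definition coord i (x : M) : Rr := sval (cid coordinates_exist) x ord0 i.

Lemma coord_expand x : x = \sum_(i < m) coord i x *: e i.
Proof. by have [h _] := svalP (cid coordinates_exist); exact: h. Qed.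

Lemma coord_unique x (d : 'I_m -> Rr) : x = \sum_(i < m) d i *: e i ->
  forall i, coord i x = d i.
Proof.
move=> hd i; have [_ h] := svalP (cid coordinates_exist).
rewrite /coord (h x (\row_j d j)) ?mxE // {1}hd.
by apply: eq_bigr => j _; rewrite mxE.
Qed.

Lemma coordB i : zmod_morphism (coord i).
Proof.
move=> x y; move: i; apply: coord_unique.
rewrite [in LHS](coord_expand x) [in LHS](coord_expand y) -sumrB.
by apply: eq_bigr => i _; rewrite scalerBl.
Qed.

Lemma coordZ i f x : coord i (f *: x) = f * coord i x.
Proof.
move: i; apply: coord_unique.
rewrite [in LHS](coord_expand x) scaler_sumr.
by apply: eq_bigr => i _; rewrite scalerA.
Qed.

Lemma coord_basis i j : coord i (e j) = (i == j)%:R.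
Proof.
move: i; apply: coord_unique; rewrite (bigD1 j) //= eqxx scale1r big1 ?addr0 // => i.
by move=> /negPf ->; rewrite scale0r.
Qed.

(** The coordinates with respect to [e], extended to the tensor product by its
    universal property. *)
Lemma ext_coordinates_exist i : exists phi : {additive am_ext P -> RG},
  forall x c, phi (tens x c) = cst c * Rval (coord i x).
Proof.
have [_ /(_ RG (fun x c => cst c * Rval (coord i x))) h] := am_tensP P.
have [|[phi hphi] _] := h; last by exists phi; exact: hphi.
split.
- by move=> c x y; rewrite coordB -mulrBr.
- by move=> x c d; rewrite rmorphB mulrBl.
- move=> a x c; rewrite coordZ rmorphM [Rval (_ * _)]/(Rval _ * Rval _) /=.
  by rewrite mulrCA mulrA.
Qed.

Definition ext_coord i : {additive am_ext P -> RG} :=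
  sval (cid (ext_coordinates_exist i)).

Lemma ext_coord_tens i x c : ext_coord i (tens x c) = cst c * Rval (coord i x).
Proof. exact: (svalP (cid (ext_coordinates_exist i))). Qed.

(** Both sides are additive in [y] and agree on pure tensors. *)
Lemma ext_expand y : y = \sum_(i < m) ext_coord i y *: tens (e i) 1.
Proof.
have [_ /(_ (am_ext P) tens) h] := am_tensP P.
have [_ u] := h (proj1 (am_tensP P)).
pose f y := \sum_(i < m) ext_coord i y *: tens (e i) 1.
have hB : zmod_morphism f.
  by move=> z w; rewrite -sumrB; apply: eq_bigr => i _; rewrite raddfB scalerBl.
pose f' : {additive am_ext P -> am_ext P} := HB.pack f
  (GRing.isZmodMorphism.Build _ _ _ hB).
apply: (u idfun f') => x c; rewrite /= /f {1}(coord_expand x) tens_suml.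
by apply: eq_bigr => i _; rewrite ext_coord_tens scale_tens mulr1.
Qed.

(** The tensor product is only given by its universal property; the expansion in
    the basis shows that pure tensors generate it. *)
Lemma ext_ind (Q : am_ext P -> Prop) : Q 0 -> (forall y z, Q y -> Q z -> Q (y + z)) ->
  (forall x c, Q (tens x c)) -> forall y, Q y.
Proof.
move=> Q0 QD Qt y; rewrite (ext_expand y); elim/big_ind: _ => // i _.
have [s ->] := RGam_comb (ext_coord i y); rewrite comb_tens.
by elim/big_ind: _.
Qed.

Lemma ext_coordZ i f y : ext_coord i (f *: y) = f * ext_coord i y.
Proof.
move: y; apply: ext_ind => [|y z hy hz|x c].
- by rewrite scaler0 raddf0 mulr0.
- by rewrite scalerDr !raddfD hy hz mulrDr.
have [s ->] := RGam_comb f; rewrite comb_tens raddf_sum /comb mulr_suml.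
apply: eq_bigr => g _; rewrite !ext_coord_tens coordZ rmorphM.
by rewrite [Rval (_ * _)]/(Rval _ * Rval _) mulrACA.
Qed.

Lemma ext_coord_basis i j : ext_coord i (tens (e j) 1) = (i == j)%:R.
Proof.
by rewrite ext_coord_tens rmorph1 mul1r coord_basis; case: eqP.
Qed.

Lemma ext_coord_sum i (c : 'I_m -> RG) :
  ext_coord i (\sum_(j < m) c j *: tens (e j) 1) = c i.
Proof.
rewrite raddf_sum (bigD1 i) //= ext_coordZ ext_coord_basis eqxx mulr1.
rewrite big1 ?addr0 // => j ji; rewrite ext_coordZ ext_coord_basis eq_sym (negPf ji).
by rewrite mulr0.
Qed.

Section Galois.
Variables (sigma : {rmorphism KG -> KG}) (g : {additive am_ext P -> am_ext P}).
Hypothesis sK : forall a : fK S, sigma (embG a) = embG a.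
Hypothesis gt : forall x c, g (tens x c) = tens x (sigma c).

Lemma galois_scale c y : g (cst c *: y) = cst (sigma c) *: g y.
Proof.
move: y; apply: ext_ind => [|y z hy hz|x d].
- by rewrite scaler0 raddf0 scaler0.
- by rewrite scalerDr !raddfD /= hy hz.
by rewrite cst_tens !gt cst_tens rmorphM.
Qed.

(** The basis consists of elements fixed by [g], and the coordinates of the
    elements of [am_mod P] have coefficients in [K]. *)
Lemma galois_coord i y k : ext_coord i (g y) k = sigma (ext_coord i y k).
Proof.
move: y; apply: ext_ind => [|y z hy hz|x d].
- by rewrite !raddf0.
- rewrite !raddfD.
  by rewrite [LHS](congr2 +%R hy hz) -raddfD.
rewrite gt !ext_coord_tens !RGconstE rmorphM.
by have [a ->] := Rrho_coef (coord i x) k; rewrite sK.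
Qed.

End Galois.

(** * Isotypic projectors *)

Section Projectors.
Hypothesis sl : semilinear_action P.

Lemma act_zmod_morphism z : inGamma z -> zmod_morphism (act z).
Proof. by case: sl => h _ _ _; exact: h. Qed.

Lemma act_sum z (T : Type) (s : seq T) (F : T -> am_ext P) : inGamma z ->
  act z (\sum_(t <- s) F t) = \sum_(t <- s) act z (F t).
Proof.
move=> hz; pose h : {additive am_ext P -> am_ext P} := HB.pack (act z)
  (GRing.isZmodMorphism.Build _ _ _ (act_zmod_morphism hz)).
exact: (raddf_sum h).
Qed.

Lemma act_scale z c y : inGamma z -> act z (cst c *: y) = cst c *: act z y.
Proof.
case: sl => _ h _ _ hz; rewrite h //; congr (_ *: _).
apply: RGam_ext => i; rewrite zstarE //= /unit_series.
case: eqP => [->|_]; last by rewrite mulr0.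
by rewrite /lmonom big1 ?mul1r // => j _; rewrite mxE expr0z.
Qed.

Lemma inGamma_sW k (z : 'I_n -> KG) : inGamma_s k z -> inGamma z.
Proof.
move=> hz j; exists k.+1 => //.
by have := hz j; rewrite !unity_rootE expnSr exprM => /eqP ->; rewrite expr1n.
Qed.

Lemma prm_exp_neq0 k : (p ^ k)%:R != 0 :> KG.
Proof.
rewrite -(rmorph_nat (@embG _ S)) fmorph_eq0.
by have /pcharf0P -> := fK_char0 S; rewrite -lt0n prm_exp_gt0.
Qed.

(** The exponent [n * k] makes the normalizing factor the inverse of the order
    of [Gamma_k^n]. *)
Definition projector k (a : 'I_n -> nat) (y : am_ext P) : am_ext P :=
  cst ((p ^ (n * k))%:R)^-1 *:
    \sum_(z <- Gamma_seq S n k) cst (gchar z a)^-1 *: act z y.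

(** Replace the summation variable [w] by [z w]. *)
Lemma act_projector k a y (z : 'I_n -> KG) : inGamma_s k z ->
  act z (projector k a y) = cst (gchar z a) *: projector k a y.
Proof.
move=> hz; have hz' := inGamma_sW hz.
have z0 j : z j != 0 by apply: unity_root_neq0 (hz j); rewrite prm_exp_gt0.
rewrite /projector act_scale // act_sum // scalerA mulrC -scalerA; congr (_ *: _).
rewrite scaler_sumr.
pose h (w : {ffun 'I_n -> KG}) : {ffun 'I_n -> KG} := [ffun j => z j * w j].
rewrite -[RHS](@Gamma_seq_reindex _ _ _ _ _ h) => [|w w' /ffunP e'|w hw j]; last 2 first.
- by apply/ffunP => j; have := e' j; rewrite !ffunE => /(mulfI (z0 j)).
- rewrite ffunE unity_rootE exprMn; have := hz j; have := hw j.
  by rewrite !unity_rootE => /eqP -> /eqP ->; rewrite mulr1.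
rewrite big_seq [RHS]big_seq; apply: eq_bigr => w /Gamma_seqP hw.
rewrite act_scale // (_ : (h w : 'I_n -> KG) = fun j => z j * w j); last first.
  by apply/funext => j; rewrite ffunE.
case: sl => _ _ _ ->//; last exact: inGamma_sW hw.
rewrite scalerA -rmorphM gcharM invfM mulrA mulfV ?mul1r //.
by apply: (@unity_root_neq0 _ S (p ^ k)); rewrite ?prm_exp_gt0 // gchar_unity_root.
Qed.

Lemma projector0 a y : projector 0 a y = y.
Proof.
have e0 : Gamma_seq S n 0 = [:: [ffun=> 1]].
  apply/perm_small_eq => //; apply: uniq_perm; rewrite ?Gamma_seq_uniq // => z.
  rewrite inE; apply/idP/eqP => [/Gamma_seqP hz|->].
    by apply/ffunP => j; rewrite ffunE; have := hz j; rewrite unity_rootE => /eqP.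
  by apply/Gamma_seqP => j; rewrite ffunE unity_rootE.
rewrite /projector e0 muln0 expn0 invr1 rmorph1 scale1r big_seq1.
rewrite (_ : ([ffun=> 1] : {ffun 'I_n -> KG}) = (fun=> 1) :> ('I_n -> KG)); last first.
  by apply/funext => j; rewrite ffunE.
case: sl => _ _ -> _; rewrite /gchar big1 ?invr1 ?rmorph1 ?scale1r // => j _.
exact: expr1n.
Qed.

(** Exchange the sums: by orthogonality, the sum over [d] of the characters kills
    the terms outside [Gamma_k^n] and multiplies the others by [p^n], which
    accounts for the change of normalization. *)
Lemma projector_refine k a y : projector k a y =
  \sum_(d : {ffun 'I_n -> 'I_p}) projector k.+1 (fun i => a i + p ^ k * d i)%N y.
Proof.
rewrite /projector -scaler_sumr exchange_big /=.
rewrite mulnS addnC expnD natrM invfM rmorphM -scalerA; congr (_ *: _).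
rewrite -(@Gamma_seq_sub _ S n k) scaler_sumr.
rewrite big_seq [RHS]big_seq; apply: eq_bigr => z /Gamma_seqP hz.
rewrite -scaler_suml -rmorph_sum.
under eq_bigr do rewrite gcharD invfM.
rewrite -mulr_sumr gchar_sum //; case: ifP => _; last by rewrite mulr0 rmorph0 !scale0r scaler0.
by rewrite scalerA -rmorphM mulrCA mulVf ?mulr1 // prm_exp_neq0.
Qed.

(** An automorphism permutes [Gamma_k^n]; replace the summation variable [w] by
    [sigma w]. *)
Lemma galois_projector (sigma : {rmorphism KG -> KG})
    (g : {additive am_ext P -> am_ext P}) k a x :
  (forall x c, g (tens x c) = tens x (sigma c)) ->
  (forall z y, inGamma z -> g (act z y) = act (fun j => sigma (z j)) (g y)) ->
  g (projector k a (tens x 1)) = projector k a (tens x 1).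
Proof.
move=> gt ga; rewrite /projector (galois_scale gt) raddf_sum fmorphV rmorph_nat.
congr (_ *: _).
pose h (w : {ffun 'I_n -> KG}) : {ffun 'I_n -> KG} := [ffun j => sigma (w j)].
rewrite -[RHS](@Gamma_seq_reindex _ _ _ _ _ h) => [|w w' /ffunP e'|w hw j]; last 2 first.
- by apply/ffunP => j; have := e' j; rewrite !ffunE => /fmorph_inj.
- rewrite ffunE unity_rootE -rmorphXn; have := hw j.
  by rewrite unity_rootE => /eqP ->; rewrite rmorph1.
rewrite big_seq [RHS]big_seq; apply: eq_bigr => w /Gamma_seqP hw.
rewrite (galois_scale gt) ga ?gt ?rmorph1; last exact: inGamma_sW hw.
rewrite (_ : (h w : 'I_n -> KG) = fun j => sigma (w j)); last first.
  by apply/funext => j; rewrite ffunE.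
rewrite fmorphV /gchar rmorph_prod; congr (cst _^-1 *: _).
by apply: eq_bigr => j _; rewrite rmorphXn.
Qed.

Definition projector_mx k (a : 'I_m -> 'I_n -> nat) : 'M[RG]_m :=
  \matrix_(i, j) ext_coord i (projector k (a j) (tens (e j) 1)).

Lemma projector_mx0 a : projector_mx 0 a = 1%:M.
Proof. by apply/matrixP => i j; rewrite !mxE projector0 ext_coord_basis. Qed.

(** Refine each column and expand by multilinearity; in Leibniz' formula this
    is the distributivity of products over sums. *)
Lemma det_projector_mx k a : \det (projector_mx k a) =
  \sum_(D : {ffun 'I_m -> {ffun 'I_n -> 'I_p}})
     \det (projector_mx k.+1 (fun j i => a j i + p ^ k * D j i)%N).
Proof.
rewrite -det_tr; under [RHS]eq_bigr do rewrite -det_tr.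
rewrite /determinant.
rewrite exchange_big /=; apply: eq_bigr => s _; rewrite -mulr_sumr; congr (_ * _).
rewrite (eq_bigr (fun j => \sum_(d : {ffun 'I_n -> 'I_p})
    ext_coord (s j) (projector k.+1 (fun i => a j i + p ^ k * d i)%N (tens (e j) 1)))).
  by rewrite bigA_distr_bigA; apply: eq_bigr => D _; apply: eq_bigr => j _; rewrite !mxE.
by move=> j _; rewrite !mxE projector_refine raddf_sum.
Qed.

End Projectors.
End Coordinates.

(** * Bases over a subring *)

Section BasisChange.
Variables (A : comNzRingType) (M : lmodType A) (B : set A) (X : set M) (m : nat).
Implicit Types (e : 'I_m -> M) (c : 'rV[A]_m).

(** The transition matrices between [e0] and [e] are inverse to each other: one
    of the two products is the identity because [e0] is free, and the other
    because square matrices over a commutative ring have two-sided inverses. *)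
Lemma basis_change e0 e : B 0 -> B 1 -> is_basis B X e0 ->
  is_basis [set: A] [set: M] e0 -> is_basis B X e ->
  is_basis [set: A] [set: M] e.
Proof.
move=> B0 B1 [hX _] [_ h0] [_ hY].
pose vec e c := \sum_(i < m) c ord0 i *: e i.
have comp e1 e2 (T : 'M[A]_m) c : (forall j, e1 j = vec e2 (row j T)) ->
    vec e1 c = vec e2 (c *m T).
  move=> h; rewrite /vec.
  transitivity (\sum_i \sum_j (c ord0 i * T i j) *: e2 j).
    apply: eq_bigr => i _; rewrite h /vec scaler_sumr; apply: eq_bigr => j _.
    by rewrite scalerA mxE.
  rewrite exchange_big; apply: eq_bigr => j _; rewrite -scaler_suml; congr (_ *: _).
  by rewrite mxE.
have vec_delta e1 j : vec e1 (delta_mx ord0 j) = e1 j.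
  rewrite /vec (bigD1 j) //= mxE !eqxx scale1r big1 ?addr0 // => i /negPf ij.
  by rewrite mxE ij scale0r.
have /choice[T hT] : forall j, exists c, e0 j = vec e c.
  move=> j; have [|c [[_ hc] _]] := hY (e0 j); last by exists c.
  rewrite -(vec_delta e0 j); apply: hX => i; rewrite mxE.
  by case: (_ && _).
have /choice[U hU] : forall j, exists c, e j = vec e0 c.
  by move=> j; have [c [[_ hc] _]] := h0 (e j) Logic.I; exists c.
pose TT := \matrix_j T j; pose UU := \matrix_j U j.
have hT' j : e0 j = vec e (row j TT) by rewrite rowK.
have hU' j : e j = vec e0 (row j UU) by rewrite rowK.
have inj0 c d : vec e0 c = vec e0 d -> c = d.
  move=> h; have [w [_ u]] := h0 (vec e0 c) Logic.I.
  by rewrite -(u c) // -(u d).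
have TU : TT *m UU = 1%:M.
  apply/row_matrixP => j; apply: inj0.
  rewrite row_mul -(comp e e0 UU _ hU') -hT' row1 vec_delta //.
have UT := mulmx1C TU.
split=> // x _; have [c [[_ hc] _]] := h0 x Logic.I.
exists (c *m TT); split.
  by split=> //; rewrite hc; exact: (comp e0 e).
move=> d [_ hd]; have hd' : vec e0 c = vec e0 (d *m UU).
  by rewrite -(comp e e0 UU d hU') -[LHS]hc; exact: hd.
by rewrite (inj0 _ _ hd') -mulmxA UT mulmx1.
Qed.

End BasisChange.

(** * Existence of exponents *)

Section Exponent.
Variables (R : realType) (S : padic_setting R) (n : nat).
Variable rho : 'I_n -> {posnum R}.
Local Notation p := (prm S).
Local Notation KG := (KGamma S).
Local Notation Rr := (Rrho S rho).
Local Notation RG := (RGam S rho).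
Local Notation aG := (@absG R S).

Lemma KJ_unit_series a b (c : fK S) : KJ a b (unit_series (n := n) (embG c)).
Proof.
exists (unit_series c); first by move=> r _; exact/unit_decays/absK_nonarch.
by apply/funext => i; rewrite /unit_series; case: eqP; rewrite ?rmorph0.
Qed.

Lemma zeta_powE k m (z : 'I_n -> KG) (A : 'I_n -> 'I_m -> padic_int p) :
  zeta_pow k z A = diag_mx (\row_j gchar z (fun i => zres (A i j) k)).
Proof.
rewrite /zeta_pow /gchar.
elim: (index_enum _) => [|i s IH].
  by rewrite big_nil; apply/matrixP => i j; rewrite !mxE big_nil.
rewrite big_cons IH mulmx_diag; congr diag_mx; apply/rowP => j.
by rewrite !mxE big_cons.
Qed.

Lemma absG_pX k : aG (p ^ k)%:R = (p%:R ^+ k)^-1.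
Proof.
rewrite -(rmorph_nat (@embG _ S)) absG_embG.
elim: k => [|k IH]; first by rewrite (nabs1 (absK_nonarch S)) expr0 invr1.
by rewrite expnS natrM (nabsM (absK_nonarch S)) IH absK_prm exprS invfM.
Qed.

Lemma nonarch_sum_ge1 (T : finType) (x : T -> KG) :
  1 <= aG (\sum_t x t) -> exists t, 1 <= aG (x t).
Proof.
move=> h; apply: contrapT => hx; move: h; apply/negP; rewrite -ltNge.
apply: (nabs_sum_lt (absG_nonarch S)) => // t _; rewrite ltNge; apply/negP => ht.
by apply: hx; exists t.
Qed.

Variable P : action_module S rho.
Local Notation M := (am_mod P).
Local Notation m := (am_rank P).
Local Notation tens := (@am_tens _ _ _ _ P).
Local Notation act := (@am_act _ _ _ _ P).
Variable e : 'I_m -> M.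
Hypothesis be : is_basis [set: Rr] [set: M] e.
Hypothesis sl : semilinear_action P.

(** The choice of the digits.  Looking at the constant coefficient of the
    determinant rather than at its norm makes the ultrametric inequality
    applicable to a finite sum in the field [K(Gamma)]. *)
Lemma digits_exist : exists a : nat -> 'I_m -> 'I_n -> nat,
  [/\ forall k j i, (a k j i < p ^ k)%N,
      forall k j i, (a k.+1 j i %% p ^ k)%N = a k j i &
      forall k, 1 <= aG (RGcoef (\det (projector_mx be k (a k))) 0)].
Proof.
pose Q k (a : 'I_m -> 'I_n -> nat) := (forall j i, (a j i < p ^ k)%N) /\
   1 <= aG (RGcoef (\det (projector_mx be k a)) 0).
have step k (a : {a | Q k a}) :
    {a' | Q k.+1 a' & forall j i, (a' j i %% p ^ k)%N = sval a j i}.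
  case: a => a [ap ha] /=; apply: cid2.
  move: ha; rewrite (det_projector_mx be) RGcoef_sum => /nonarch_sum_ge1[D hD].
  exists (fun j i => a j i + p ^ k * D j i)%N; last first.
    by move=> j i; rewrite addnC mulnC modnMDl modn_small.
  split=> // j i; rewrite expnSr.
  apply: (@leq_trans (p ^ k + p ^ k * D j i)); first by rewrite ltn_add2r.
  by rewrite -mulnS leq_mul2l ltn_ord orbT.
have Q0 : Q 0%N (fun _ _ => 0%N).
  split=> //; rewrite projector_mx0 // det1 /= /unit_series eqxx.
  by rewrite (nabs1 (absG_nonarch S)).
pose W := fix W k : {a | Q k a} :=
  if k is k'.+1 then exist _ (s2val (step k' (W k'))) (s2valP (step k' (W k')))
  else exist _ _ Q0.
exists (fun k => sval (W k)); split=> k.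
- by move=> j i; have [h _] := svalP (W k).
- by move=> j i; rewrite /= (s2valP' (step k (W k))).
- by have [_ h] := svalP (W k).
Qed.

Section Entries.
Variables (k : nat) (E : {ffun 'I_n -> KG} -> 'M[RG]_m).
Hypothesis hE : forall z : {ffun 'I_n -> KG}, inGamma_s k z ->
  forall j, act z (tens (e j) 1) = \sum_(i < m) E z i j *: tens (e i) 1.

Lemma projector_mxE a i j x : RGcoef (projector_mx be k a i j) x =
  \sum_(z <- Gamma_seq S n k)
    ((p ^ (n * k))%:R^-1 * (gchar z (a j))^-1) * RGcoef (E z i j) x.
Proof.
rewrite mxE /projector ext_coordZ raddf_sum mulr_sumr RGcoef_sum.
rewrite big_seq [RHS]big_seq; apply: eq_bigr => z /Gamma_seqP hz.
by rewrite ext_coordZ hE // ext_coord_sum !RGconstE mulrA.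
Qed.

Lemma projector_mx_KJG a b : (forall z : {ffun 'I_n -> KG}, inGamma_s k z ->
    forall i j, KJG a b (RGcoef (E z i j))) ->
  forall d i j, KJG a b (RGcoef (projector_mx be k d i j)).
Proof.
move=> h d i j; rewrite (funext (projector_mxE d i j)).
by apply: KJG_sum => z /Gamma_seqP hz; exact: h.
Qed.

(** Roots of unity have absolute value 1, so only the factor [p^{-nk}] worsens
    the bound on the action. *)
Lemma projector_mx_norm a b l : (forall z : {ffun 'I_n -> KG}, inGamma_s k z ->
    (mx_norm a b (fun i j => RGcoef (E z i j)) <= (p%:R ^+ (l * k))%:E)%E) ->
  forall d, (mx_norm a b (fun i j => RGcoef (projector_mx be k d i j))
     <= (p%:R ^+ ((l + n) * k))%:E)%E.
Proof.
move=> h d; have hv := absG_nonarch S.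
have px q : 0 < (p%:R : R) ^+ q by rewrite exprn_gt0 // ltr0n prime_gt0 ?prm_prime.
apply/mx_norm_le; first exact: ltW.
move=> i j; apply/sup_norm_le => r x hr; rewrite projector_mxE.
rewrite -ler_pdivlMr ?lmonom_gt0 //; apply: (nabs_sum_le hv).
  by rewrite divr_ge0 // ltW // lmonom_gt0.
move=> z /Gamma_seqP hz; rewrite ler_pdivlMr ?lmonom_gt0 // !(nabsM hv).
rewrite [X in _ * X * _](absG_unity_root (prm_exp_gt0 S k)); last first.
  by rewrite unity_rootE exprVn invr_eq1 -unity_rootE; exact: gchar_unity_root.
have -> : aG (p ^ (n * k))%:R^-1 = p%:R ^+ (n * k).
  apply: (mulIf (x := aG (p ^ (n * k))%:R)).
    by rewrite absG_pX invr_eq0 gt_eqF.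
  by rewrite -(nabsM hv) mulVf ?prm_exp_neq0 // (nabs1 hv) absG_pX mulfV ?gt_eqF.
rewrite mulr1 -mulrA mulnDl exprD mulrC; apply: ler_wpM2r; first exact: ltW.
have h1 := proj1 (mx_norm_le _ _ _ (ltW (px (l * k)%N))) (h z hz) i j.
exact: (proj1 (sup_norm_le _ _ _ _) h1).
Qed.

End Entries.

Lemma projector_mx_galois a k : galois_compatible P ->
  forall (sigma : {rmorphism KG -> KG}), bijective sigma ->
    (forall x : fK S, sigma (embG x) = embG x) ->
  forall i j x, sigma (RGcoef (projector_mx be k a i j) x)
    = RGcoef (projector_mx be k a i j) x.
Proof.
move=> gc sigma bs sK i j x; have [g gt ga] := gc sigma bs sK.
by rewrite mxE -(galois_coord be sK gt) (galois_projector be k (a j) (e j) gt ga).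
Qed.

End Exponent.

Theorem theorem3p2 (R : realType) (S : padic_setting R) (n : nat)
    (n_gt0 : (0 < n)%N) (rho : 'I_n -> {posnum R}) (P : objC S rho) :
  exists A : 'I_n -> 'I_(am_rank P) -> padic_int (prm S), is_exponent A.
Proof.
have [a [b [P' dP]]] := ob_defined P.
have [ab [e0 be0' be0] _ [e be' [l l0 hb]]] := dP.
(* The basis in which the action is bounded need not be the one that witnesses
   that P is extended from P'. *)
have be : is_basis [set: Rrho S rho] [set: am_mod P] e.
  apply: basis_change be0' be0 be'.
    rewrite /KJ_rho /=; exists (fun=> 0); last by apply/funext => i; rewrite rmorph0.
    move=> r _ eps eps0; exists 0%N => i _.
    by rewrite (nabs0 (absK_nonarch S)) mul0r.
  by have := @KJ_unit_series _ S n a b 1; rewrite rmorph1.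
have sl := ob_semilinear P.
have [d [_ dm dd]] := digits_exist be sl.
pose A i j := MkPadicInt (zres := fun k => d k j i) (fun k => dm k j i).
pose T k := projector_mx be k (d k).
have entries k : (0 < k)%N -> (forall i j, KJG a b (RGcoef (T k i j))) /\
    (mx_norm a b (fun i j => RGcoef (T k i j)) <= ((prm S)%:R ^+ ((l + n) * k))%:E)%E.
  move=> k0.
  have /choice[E hE] : forall z : {ffun 'I_n -> KGamma S},
      exists E : 'M[RGam S rho]_(am_rank P), inGamma_s k z ->
      [/\ forall i j, KJG a b (RGcoef (E i j)),
          forall j, am_act z (am_tens (e j) 1)
            = \sum_(i < am_rank P) E i j *: am_tens (e i) 1 &
          (mx_norm a b (fun i j => RGcoef (E i j)) <= ((prm S)%:R ^+ (l * k))%:E)%E].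
    move=> z; have [/(hb k z k0)[E hE]|nz] := pselect (inGamma_s k z); first by exists E.
    by exists 0 => /nz.
  split.
    by apply: (@projector_mx_KJG _ _ _ _ _ _ be _ E) => z /hE[].
  by apply: (@projector_mx_norm _ _ _ _ _ _ be _ E) => z /hE[].
have TK k i j : (0 < k)%N -> KJ a b (RGcoef (T k i j)).
  move=> k0; apply: KJG_fixed; first exact: (entries k k0).1.
  by move=> sigma bs sK x; apply: projector_mx_galois (ob_galois P) _ bs sK _ _ _.
have /choice[Sk hS] : forall k, exists Sk : 'M[Rrho S rho]_(am_rank P),
    (0 < k)%N -> map_mx val Sk = T k.
  (* The bound on the action, hence the decay of the entries, starts at k = 1. *)
  case=> [|k]; first by exists 0.
  have hT i j : T k.+1 i j \in @in_Rrho _ S _ rho.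
    by apply/asboolP; exists a, b; split=> //; apply: TK.
  exists (\matrix_(i, j) MkRrho (hT i j)) => _.
  by apply/matrixP => i j; rewrite !mxE.
have SkE k i j : (0 < k)%N -> Rval (Sk k i j) = T k i j.
  by move=> /hS <-; rewrite mxE.
have vE k j : (0 < k)%N ->
    am_tens (\sum_(i < am_rank P) Sk k i j *: e i) 1 =
    projector (P := P) k (d k j) (am_tens (e j) 1).
  move=> k0; rewrite tens_suml [RHS](ext_expand be); apply: eq_bigr => i _.
  by rewrite -val_tens SkE // mxE.
exists A, a, b, P', e; split=> //; exists Sk; split.
- by move=> k i j k0; rewrite /KJ_rho /= SkE //; exact: TK.
- move=> k z j k0 hz; rewrite vE // act_projector // -vE //.
  rewrite [RHS](bigD1 j) //= [X in _ = _ + X]big1 => [|i ij]; rewrite zeta_powE !mxE.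
    by rewrite eqxx mulr1n addr0 cst_tens mulr1.
  by rewrite (negPf ij) mulr0n raddf0.
- exists (l + n)%N; first by rewrite addn_gt0 l0.
  move=> k k0; have [_ hN] := entries k k0; apply: le_trans hN.
  rewrite le_eqVlt; apply/orP; left; apply/eqP; congr (mx_norm a b _).
  by apply/funext => i; apply/funext => j; rewrite SkE.
- move=> k k0.
  have rhoJ : polysegment a b rho by move=> j; have /andP[/ltW-> /ltW->] := ab j.
  apply: le_trans (sup_norm_ge _ 0 rhoJ).
  rewrite /lmonom big1 ?mulr1; last by move=> i _; rewrite mxE expr0z.
  by rewrite lee_fin -[Rval _]/(val _) -det_map_mx hS //; exact: dd.
Qed.
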